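(* Suppose that $a_n\to\infty$, $\beta_n\to\beta_\infty$ as $n\to\infty$ with $|\beta_\infty|<1$, that $(\alpha_n')\in\ell^1(\mathbb Z_+)$, $(\beta_n')\in\ell^1(\mathbb Z_+)$, $(k_n-1)\in\ell^1$, and that the Carleman condition $\sum_{n=0}^\infty a_n^{-1}=\infty$ is satisfied. Then the spectrum of the Jacobi operator $J$ is absolutely continuous.
   Context: $\mathbb Z_+=\{0,1,2,\dots\}$; $a_n>0$ and $b_n\in\mathbb R$ for $n\in\mathbb Z_+$, and $a_{-1}>0$ is an arbitrary fixed number. For a sequence $x_n$ put $x_n'=x_{n+1}-x_n$. Notation: $$\alpha_n=\frac1{2\sqrt{a_{n-1}a_n}},\quad \beta_n=-\frac{b_n}{2\sqrt{a_{n-1}a_n}},\quad k_n=\frac{a_n}{\sqrt{a_{n-1}a_{n+1}}}.$$ The minimal Jacobi operator $J_{\min}$ acts in $\ell^2(\mathbb Z_+)$ on the set of sequences with finitely many non-zero components by $(J_{\min}u)_0=b_0u_0+a_0u_1$, $(J_{\min}u)_n=a_{n-1}u_{n-1}+b_nu_n+a_nu_{n+1}$ for $n\ge1$. Under the Carleman condition it is essentially self-adjoint, and $J$ denotes its closure. *)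

(* Defs.v *)
From HB Require Import structures.
From mathcomp Require Import all_boot all_order all_algebra.
From mathcomp Require Import all_classical all_reals all_analysis.
From mathcomp Require Import complex.
From mathcomp Require Import ring.
Set Implicit Arguments.
Unset Strict Implicit.
Unset Printing Implicit Defensive.
Import Order.TTheory GRing.Theory Num.Theory.
Import numFieldNormedType.Exports.
Import Normc.
Local Open Scope classical_set_scope.
Local Open Scope complex_scope.
Local Open Scope ring_scope.

Definition sqnorm2 (R : realType) (u : nat -> R[i]^o) : \bar R :=
  (\sum_(0 <= n <oo) (normc (u n) ^+ 2)%:E)%E.

Definition in_l2 (R : realType) : {pred nat -> R[i]^o} :=
  fun u => (sqnorm2 u < +oo)%E.
Arguments in_l2 R : clear implicits.

Lemma sqr_normcZ (R : realType) (c z : R[i]) :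
  normc (c * z) ^+ 2 = normc c ^+ 2 * normc z ^+ 2.
Proof. by rewrite normcM exprMn. Qed.

Lemma sqr_normcD (R : realType) (y z : R[i]) :
  normc (y + z) ^+ 2 <= 2 * normc y ^+ 2 + 2 * normc z ^+ 2.
Proof.
have h : normc (y + z) ^+ 2 <= (normc y + normc z) ^+ 2.
  rewrite lerXn2r ?nnegrE ?addr_ge0 //.
  - by case: (y + z) => a b; exact: sqrtr_ge0.
  - by case: y => a b; exact: sqrtr_ge0.
  - by case: z => a b; exact: sqrtr_ge0.
  - exact: le_normcD.
apply: (le_trans h); rewrite -subr_ge0.
have -> : 2 * normc y ^+ 2 + 2 * normc z ^+ 2 - (normc y + normc z) ^+ 2
    = (normc y - normc z) ^+ 2.
  by ring.
exact: sqr_ge0.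
Qed.

Lemma in_l2_submod_closed (R : realType) : submod_closed (in_l2 R).
Proof.
split.
- rewrite unfold_in /sqnorm2 eseries0// => n _ _.
  by rewrite [X in normc X](_ : _ = 0%C)// normc0 expr0n.
- move=> c u v; rewrite !unfold_in /sqnorm2 => hu hv.
  have nn (w : nat -> R[i]^o) n : (0 <= (normc (w n) ^+ 2)%:E)%E.
    by rewrite lee_fin sqr_ge0.
  apply: (@le_lt_trans _ _
    ((2 * normc c ^+ 2)%:E * \sum_(0 <= n <oo) (normc (u n) ^+ 2)%:E
     + 2%:E * \sum_(0 <= n <oo) (normc (v n) ^+ 2)%:E)%E); last first.
    by apply: lte_add_pinfty; apply: lte_mul_pinfty => //;
      rewrite lee_fin mulr_ge0// sqr_ge0.
  rewrite -!nneseriesZl//.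
  rewrite -nneseriesD; first last.
  - by move=> n _ _; rewrite mule_ge0.
  - by move=> n _ _; rewrite mule_ge0// lee_fin mulr_ge0// sqr_ge0.
  apply: lee_nneseries => n _ //.
  rewrite -!EFinM -EFinD lee_fin -mulrA -sqr_normcZ.
  exact: sqr_normcD.
Qed.

HB.instance Definition _ (R : realType) :=
  GRing.isSubmodClosed.Build R[i] (nat -> R[i]^o) (in_l2 R)
    (@in_l2_submod_closed R).

Record l2 (R : realType) := L2 {
  l2_val :> nat -> R[i]^o ;
  l2P : l2_val \in in_l2 R }.

HB.instance Definition _ (R : realType) := [isSub for @l2_val R].
HB.instance Definition _ (R : realType) := [Choice of l2 R by <:].
HB.instance Definition _ (R : realType) :=
  [SubChoice_isSubLmodule of l2 R by <:].

(* Linear in the first argument. *)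
Definition inner (R : realType) (u v : l2 R) : R[i] :=
  limn (series (fun n => u n * (v n)^* : R[i]^o)).

(* A possibly unbounded operator in l2 is identified with its graph. *)
Definition operator (R : realType) := set (l2 R * l2 R).

Definition op_domain (R : realType) (T : operator R) : set (l2 R) :=
  [set u | exists f, T (u, f)].

Definition op_closure (R : realType) (T : operator R) : operator R :=
  [set p | forall e : R, 0 < e -> exists2 q, T q &
     (sqnorm2 (p.1 - q.1)%R < e%:E)%E /\ (sqnorm2 (p.2 - q.2)%R < e%:E)%E].

Definition dense_domain (R : realType) (T : operator R) : Prop :=
  forall (u : l2 R) (e : R), 0 < e ->
    exists2 v, op_domain T v & (sqnorm2 (u - v)%R < e%:E)%E.

Definition adjoint (R : realType) (T : operator R) : operator R :=
  [set p | forall q, T q -> inner q.2 p.1 = inner q.1 p.2].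

Definition self_adjoint (R : realType) (T : operator R) : Prop :=
  dense_domain T /\ adjoint T = T.

(* Projection-valued measures on the Borel sets of the line. The values on
   non-measurable sets are irrelevant. Since every [E B] is an orthogonal
   projection, [sqnorm2 (E B u)] is [inner (E B u) u], and its countable
   additivity for all [u] is equivalent to that of [E] in the strong sense. *)
Record spectral_family (R : realType) := SpectralFamily {
  spectral_proj :> set (measurableTypeR R) -> {linear l2 R -> l2 R} ;
  spectral_proj_sym : forall B, measurable B ->
    forall u v, inner (spectral_proj B u) v = inner u (spectral_proj B v) ;
  spectral_projI : forall A B, measurable A -> measurable B ->
    forall u, spectral_proj (A `&` B) u = spectral_proj A (spectral_proj B u) ;
  spectral_proj0 : forall u, spectral_proj set0 u = 0 ;
  spectral_projT : forall u, spectral_proj setT u = u ;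
  spectral_proj_sigma_additive : forall u : l2 R,
    semi_sigma_additive (fun B => sqnorm2 (spectral_proj B u)) }.

Definition spectral_measure (R : realType) (E : spectral_family R) (u : l2 R)
    (B : set (measurableTypeR R)) : \bar R :=
  sqnorm2 (E B u).

Lemma sqnorm2_ge0 (R : realType) (u : nat -> R[i]^o) : (0 <= sqnorm2 u)%E.
Proof. by apply: nneseries_ge0 => n _ _; rewrite lee_fin sqr_ge0. Qed.

Lemma spectral_measure0 (R : realType) (E : spectral_family R) (u : l2 R) :
  spectral_measure E u set0 = 0%E.
Proof.
rewrite /spectral_measure spectral_proj0 /sqnorm2 eseries0// => n _ _.
by rewrite [X in normc X](_ : _ = 0%C)// normc0 expr0n.
Qed.

HB.instance Definition _ (R : realType) (E : spectral_family R) (u : l2 R) :=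
  isMeasure.Build _ (measurableTypeR R) R (spectral_measure E u)
    (spectral_measure0 E u) (fun B => sqnorm2_ge0 (E B u))
    (@spectral_proj_sigma_additive R E u).

(* [T] is the integral of the identity function with respect to [E]; the
   quadratic form determines [T] by polarization. *)
Definition spectral_family_of (R : realType) (T : operator R)
    (E : spectral_family R) : Prop :=
  (forall u, op_domain T u <->
     (\int[spectral_measure E u]_x (x ^+ 2)%:E < +oo)%E) /\
  (forall u f, T (u, f) ->
     inner f u = (\int[spectral_measure E u]_x x)%:C).

(* Self-adjointness is part of the definition because it is what guarantees,
   by the spectral theorem, that [E] exists (and is unique). *)
Definition absolutely_continuous_spectrum (R : realType) (T : operator R) :
    Prop :=
  self_adjoint T /\
  forall E : spectral_family R, spectral_family_of T E ->
    forall u, spectral_measure E u `<< @lebesgue_measure R.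

Definition jacobi_action (R : realType) (a b : nat -> R)
    (u : nat -> R[i]^o) (n : nat) : R[i]^o :=
  (if n is m.+1 then (a m)%:C * u m else 0)
  + (b n)%:C * u n + (a n)%:C * u n.+1.

Definition jacobi_min (R : realType) (a b : nat -> R) : operator R :=
  [set p : l2 R * l2 R | (exists N : nat, forall n, (N <= n)%N -> p.1 n = 0) /\
     (forall n, p.2 n = jacobi_action a b p.1 n)].

Definition jacobi (R : realType) (a b : nat -> R) : operator R :=
  op_closure (jacobi_min a b).

(* [am] stands for a_(-1), so that [lag am a n] is a_(n-1). *)
Definition lag (R : realType) (am : R) (a : nat -> R) (n : nat) : R :=
  if n is m.+1 then a m else am.

Definition jacobi_alpha (R : realType) (am : R) (a : nat -> R) (n : nat) : R :=
  1 / (2 * Num.sqrt (lag am a n * a n)).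

Definition jacobi_beta (R : realType) (am : R) (a b : nat -> R) (n : nat) : R :=
  - (b n / (2 * Num.sqrt (lag am a n * a n))).

Definition jacobi_k (R : realType) (am : R) (a : nat -> R) (n : nat) : R :=
  a n / Num.sqrt (lag am a n * a n.+1).

Definition in_l1 (R : realType) (x : nat -> R) : Prop :=
  (\sum_(0 <= n <oo) `|x n|%:E < +oo)%E.

(* Main.v *)
(** Everything rests on an a priori bound: for [|l| <= M] and [e <= 1], every
    [u] with [||(J - l) u|| <= e ||u||] satisfies [|u_m|^2 <= C e ||u||^2], where
    [C] depends only on [m] and [M].  Put [v_n = sqrt (a_n) u_n] and
    [g_n = beta_n + l alpha_n].  The equation [(J - l) u = f] becomes
    [v_(n-1) - 2 g_n v_n + k_n v_(n+1) = f_n / sqrt (a_(n-1))], and the energy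
    [v_n^2 + v_(n+1)^2 - 2 g_n v_n v_(n+1)], which is definite because
    [|beta_oo| < 1], changes at each step by a summable relative amount and by a
    term controlled by [||f|| ||u||].  Carleman's condition makes the energy of a
    square summable [u] come arbitrarily close to [0], so a backward Gronwall
    argument bounds it at every index.

    If [I] has radius [e] and centre [l], then [w = E I delta_m] satisfies
    [||(J - l) w|| <= e ||w||] and [w_m = ||w||^2], so that
    [||E I delta_m||^2 <= C e]: on bounded sets the spectral measure of [delta_m]
    is dominated by a multiple of Lebesgue measure.  Hence [E B delta_m = 0] for
    every null set [B] and every [m], and [E B = 0]. *)

Require Import Defs.
From mathcomp Require Import all_boot all_order all_algebra.
From mathcomp Require Import all_classical all_reals all_analysis.
From mathcomp Require Import measurable_realfun complex.
From mathcomp Require Import ring lra.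
Set Implicit Arguments.
Unset Strict Implicit.
Unset Printing Implicit Defensive.
Import Order.TTheory GRing.Theory Num.Theory.
Import numFieldNormedType.Exports.
Import Normc.
Local Open Scope classical_set_scope.
Local Open Scope ring_scope.
Local Open Scope complex_scope.

(** * The a priori estimate *)

Lemma in_l1_bounded (R : realType) (x : nat -> R) : in_l1 x ->
  exists S, forall m n, \sum_(m <= i < n) `|x i| <= S.
Proof.
move=> hx; exists (fine (\sum_(0 <= n <oo) `|x n|%:E)%E) => m n.
have h0 : (0 <= \sum_(0 <= n <oo) `|x n|%:E)%E.
  by apply: nneseries_ge0 => i _ _; rewrite lee_fin.
rewrite -lee_fin fineK; last by rewrite ge0_fin_numE.
apply: (@le_trans _ _ (\sum_(0 <= i < n) `|x i|%:E)%E); last first.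
  by apply: nneseries_lim_ge => i _ _; rewrite lee_fin.
rewrite sumEFin lee_fin; have [mn|/ltnW nm] := leqP m n; last first.
  by rewrite big_geq// sumr_ge0.
by rewrite [leRHS](big_cat_nat (leq0n m) mn)/= lerDr sumr_ge0.
Qed.

Lemma in_l1_cvg0 (R : realType) (x : nat -> R) : in_l1 x -> x @ \oo --> 0.
Proof.
move=> /in_l1_bounded[S hS].
suff : (fun n => `|x n|) @ \oo --> 0 by move/norm_cvg0.
apply: cvg_series_cvg_0; apply: nondecreasing_is_cvgn.
  by apply/nondecreasing_seqP => n; rewrite seriesSr lerDl.
by exists S => _ [n _ <-]; exact: hS.
Qed.

Lemma nneseries_pinfty_unbounded (R : realType) (x : nat -> R) :
  (forall n, 0 <= x n) -> (\sum_(0 <= n <oo) (x n)%:E = +oo)%E ->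
  forall m B, exists n, (m <= n)%N /\ B < \sum_(m <= i < n) x i.
Proof.
move=> x0 hx m B; apply: contrapT => /forallNP H.
have hB n : (m <= n)%N -> \sum_(m <= i < n) x i <= B.
  by move=> mn; rewrite leNgt; apply/negP => ?; exact: (H n).
have : (\sum_(0 <= n <oo) (x n)%:E <= (\sum_(0 <= i < m) x i + B)%:E)%E.
  apply: lime_le; first by apply: is_cvg_nneseries => i _ _; rewrite lee_fin.
  exists m => // n /= mn; rewrite sumEFin lee_fin (big_cat_nat (leq0n m) mn)/=.
  by rewrite lerD2l hB.
by rewrite hx leye_eq.
Qed.

(** The recursion runs downwards because the energy is known to be small only far out. Each factor
    [1 + K n] is at most [expR (K n)], which is at least 1, so all source terms fit under the full
    exponential. *)
Lemma backward_gronwall (R : realType) (G K h : nat -> R) (m N : nat) :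
  (forall n, 0 <= K n) -> (forall n, 0 <= h n) ->
  (forall n, (m <= n)%N -> 0 <= G n) ->
  (forall n, (m <= n)%N -> G n <= (1 + K n) * G n.+1 + h n) ->
  (m <= N)%N ->
  G m <= expR (\sum_(m <= i < N) K i) * (G N + \sum_(m <= i < N) h i).
Proof.
move=> K0 h0 G0 Gh; elim: N => [|N IH].
  by rewrite leqn0 => /eqP ->; rewrite !big_geq// expR0 mul1r addr0.
rewrite leq_eqVlt => /predU1P[->|].
  by rewrite !big_geq// expR0 mul1r addr0.
rewrite ltnS => mN; apply: (le_trans (IH mN)).
rewrite !big_nat_recr//= expRD -mulrA ler_wpM2l ?expR_ge0//.
have hs : 0 <= \sum_(m <= i < N) h i by exact: sumr_ge0.
have e1 := expR_ge1Dx (K N).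
have := Gh N mN; have := G0 N.+1 (leqW mN); have := h0 N; have := K0 N.
by nra.
Qed.

Lemma forward_growth (R : realType) (r K : nat -> R) (m : nat) :
  (forall n, 0 <= K n) -> (forall n, (m <= n)%N -> 0 <= r n) ->
  (forall n, (m <= n)%N -> r n.+1 <= (1 + K n) * r n) ->
  forall N, (m <= N)%N -> r N <= expR (\sum_(m <= i < N) K i) * r m.
Proof.
move=> K0 r0 rK; elim=> [|N IH].
  by rewrite leqn0 => /eqP ->; rewrite big_geq// expR0 mul1r.
rewrite leq_eqVlt => /predU1P[->|].
  by rewrite big_geq// expR0 mul1r.
rewrite ltnS => mN; apply: (le_trans (rK N mN)).
rewrite big_nat_recr//= expRD mulrAC mulrC.
by rewrite ler_pM ?addr_ge0 ?r0// ?expR_ge1Dx// IH.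
Qed.

(** * The energy form and its change over one step *)

Section energy.
Variable R : realType.
Implicit Types v g k G : R.

(** The quadratic form conserved by the constant-coefficient recurrence [v0 - 2 * g * v1 + v2 = 0].
    Its eigenvalues are [1 - g] and [1 + g]. *)
Definition energy g v0 v1 := v0 ^+ 2 + v1 ^+ 2 - 2 * g * v0 * v1.

Lemma energy_ge rho g v0 v1 : `|g| <= rho ->
  (1 - rho) * (v0 ^+ 2 + v1 ^+ 2) <= energy g v0 v1.
Proof.
rewrite /energy ler_norml => /andP[g1 g2].
have : 0 <= (rho - g) * (v0 + v1) ^+ 2.
  by rewrite mulr_ge0 ?sqr_ge0// subr_ge0.
have : 0 <= (rho + g) * (v0 - v1) ^+ 2 by rewrite mulr_ge0 ?sqr_ge0//; lra.
by lra.
Qed.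

Lemma energy_le g v0 v1 : `|g| <= 1 ->
  energy g v0 v1 <= 2 * (v0 ^+ 2 + v1 ^+ 2).
Proof.
rewrite /energy ler_norml => /andP[g1 g2].
have : 0 <= (1 - g) * (v0 - v1) ^+ 2 by rewrite mulr_ge0 ?sqr_ge0// subr_ge0.
have : 0 <= (1 + g) * (v0 + v1) ^+ 2 by rewrite mulr_ge0 ?sqr_ge0//; lra.
by lra.
Qed.

(** Dividing by the lower bound [1 - rho] of the form turns the coefficient defects into a relative
    change of energy; the residual [f] remains as an additive source. *)
Lemma energy_backward rho g0 g1 k f v0 v1 v2 : rho < 1 ->
  `|g0| <= rho -> `|g1| <= rho ->
  v0 - 2 * g1 * v1 + k * v2 = f ->
  let K := (2 * `|k - 1| + `|g1 - g0|) / (1 - rho) in K <= 1 / 2 ->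
  energy g0 v0 v1 <=
    (1 + 4 * K) * energy g1 v1 v2 + 2 * (`|f| * (`|v2| + `|v0|)).
Proof.
move=> rho1 h0 h1 hv K hK.
have G0 := energy_ge v0 v1 h0; have G1 := energy_ge v1 v2 h1.
(* For [k = 1], [g0 = g1] and [f = 0] the right side vanishes: each term measures one deviation from
   the conserved case. *)
have id : energy g0 v0 v1 - energy g1 v1 v2 =
    ((k - 1) * v2 - f) * (v2 - v0) + 2 * (g1 - g0) * (v0 * v1).
  by rewrite -hv /energy; ring.
have rho0 : 0 < 1 - rho by rewrite subr_gt0.
have KE : K * (1 - rho) = 2 * `|k - 1| + `|g1 - g0|.
  by rewrite /K divfK// gt_eqF.
have K0 : 0 <= K by rewrite /K divr_ge0 ?(ltW rho0)// addr_ge0 ?mulr_ge0.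
clearbody K.
have s2 (x : R) : x ^+ 2 = `|x| ^+ 2 by rewrite real_normK// num_real.
have v20 : `|v2 - v0| <= `|v2| + `|v0| by rewrite ler_normB.
have b1 : ((k - 1) * v2 - f) * (v2 - v0) <=
    2 * `|k - 1| * (v0 ^+ 2 + v2 ^+ 2) + `|f| * (`|v2| + `|v0|).
  apply: (le_trans (ler_norm _)); rewrite normrM.
  apply: (@le_trans _ _ ((`|k - 1| * `|v2| + `|f|) * (`|v2| + `|v0|))).
    by apply: ler_pM => //; rewrite -normrM ler_normB.
  rewrite mulrDl lerD2r (s2 v0) (s2 v2) -mulrA [2 * _]mulrC -mulrA.
  rewrite ler_wpM2l//; have := sqr_ge0 (`|v2| - `|v0|).
  by have := sqr_ge0 (`|v2| + `|v0|); nra.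
have b2 : 2 * (g1 - g0) * (v0 * v1) <= `|g1 - g0| * (v0 ^+ 2 + v1 ^+ 2).
  apply: (le_trans (ler_norm _)); rewrite !normrM ger0_norm// (s2 v0) (s2 v1).
  rewrite [2 * _]mulrC -mulrA ler_wpM2l//.
  by have := sqr_ge0 (`|v0| - `|v1|); nra.
have b3 : energy g0 v0 v1 - energy g1 v1 v2 <=
    K * (energy g0 v0 v1 + energy g1 v1 v2) + `|f| * (`|v2| + `|v0|).
  have : K * ((1 - rho) * (v0 ^+ 2 + v1 ^+ 2) + (1 - rho) * (v1 ^+ 2 + v2 ^+ 2))
      <= K * (energy g0 v0 v1 + energy g1 v1 v2).
    by rewrite ler_wpM2l// lerD.
  rewrite -mulrDr mulrA KE.
  have p1 : 0 <= `|k - 1| * v1 ^+ 2 by rewrite mulr_ge0 ?sqr_ge0.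
  have p2 : 0 <= `|g1 - g0| * v2 ^+ 2 by rewrite mulr_ge0 ?sqr_ge0.
  have p3 : 0 <= `|g1 - g0| * v1 ^+ 2 by rewrite mulr_ge0 ?sqr_ge0.
  by rewrite id; lra.
have G1p : 0 <= energy g1 v1 v2.
  by apply: le_trans G1; rewrite mulr_ge0 ?(ltW rho0)// addr_ge0 ?sqr_ge0.
have hp : 0 <= `|f| * (`|v2| + `|v0|) by rewrite mulr_ge0// addr_ge0.
move: (energy g0 v0 v1) (energy g1 v1 v2) (`|f| * _) hp G1p b3 => E0 E1 h.
move=> {KE id G0 G1 b1 b2} hp E1p b3.
(* [b3] reads [(1 - K) * E0 <= (1 + K) * E1 + h]; for [K <= 1 / 2], [(1 + K) / (1 - K) <= 1 + 4 * K]
   and [1 / (1 - K) <= 2]. *)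
have : 0 <= K * E1 * (1 / 2 - K) by rewrite !mulr_ge0// subr_ge0.
have : 0 <= K * h by rewrite mulr_ge0.
have : 0 <= h * (1 / 2 - K) by rewrite mulr_ge0// subr_ge0.
move=> q1 q2 q3.
rewrite -(@ler_pM2l _ (1 - K)); last lra.
by lra.
Qed.

End energy.

(** * Approximate solutions of the Jacobi recurrence *)

Section a_priori_estimate.
Variables (R : realType) (am : R) (a b : nat -> R) (beta_oo : R).
Hypotheses (a_gt0 : forall n, 0 < a n)
  (a_cvg : a @ \oo --> +oo)
  (beta_cvg : jacobi_beta am a b @ \oo --> beta_oo)
  (beta_oo_lt1 : `|beta_oo| < 1)
  (alpha_l1 : in_l1 (telescope (jacobi_alpha am a)))
  (beta_l1 : in_l1 (telescope (jacobi_beta am a b)))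
  (k_l1 : in_l1 (fun n => jacobi_k am a n - 1))
  (carleman : (\sum_(0 <= n <oo) ((a n)^-1)%:E = +oo)%E).

Let s n := Num.sqrt (a n).

Let s_gt0 n : 0 < s n. Proof. by rewrite sqrtr_gt0. Qed.

Let s2 n : s n ^+ 2 = a n. Proof. by rewrite sqr_sqrtr// ltW. Qed.

Let kE n : jacobi_k am a n.+1 = s n.+1 ^+ 2 / (s n * s n.+2).
Proof. by rewrite /jacobi_k /= sqrtrM ?ltW// s2. Qed.

Let alphaE n : jacobi_alpha am a n.+1 = 1 / (2 * (s n * s n.+1)).
Proof. by rewrite /jacobi_alpha /= sqrtrM ?ltW. Qed.

Let betaE n : jacobi_beta am a b n.+1 = - (b n.+1 / (2 * (s n * s n.+1))).
Proof. by rewrite /jacobi_beta /= sqrtrM ?ltW. Qed.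

Let k_near e : 0 < e -> \forall n \near \oo, `|jacobi_k am a n - 1| <= e.
Proof.
move=> e0; have := in_l1_cvg0 k_l1.
move/cvgrPdist_le => /(_ e e0); apply: filterS => n.
by rewrite sub0r normrN.
Qed.

(** With [r n = a n.+1 / a n], the square of [k_(n+1)] is [r n / r n.+1], so summability of
    [k_n - 1] bounds the products of the [k_n^(-2)], and with them the ratios. *)
Lemma jacobi_ratio_bounded :
  exists m T, 1 <= T /\ forall n, (m <= n)%N -> a n.+1 <= T * a n.
Proof.
have [S hS] := in_l1_bounded k_l1.
have /(_ (1/2)) := k_near; case; first by rewrite divr_gt0.
move=> m _ hm.
pose r n := a n.+1 / a n.
have r0 n : 0 < r n by rewrite divr_gt0.
pose K n := 6 * `|jacobi_k am a n.+1 - 1|.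
have K0 n : 0 <= K n by rewrite mulr_ge0.
have rK n : (m <= n)%N -> r n.+1 <= (1 + K n) * r n.
  move=> mn; have /= := hm n.+1 (leqW mn); rewrite /K.
  have -> : r n = jacobi_k am a n.+1 ^+ 2 * r n.+1.
    rewrite /r kE -!s2; field.
    by rewrite !gt_eqF.
  move: (jacobi_k am a n.+1) => k hk; rewrite mulrA ler_peMl ?(ltW (r0 _))//.
  have : 1 - `|k - 1| <= k by have := ler_norm (1 - k); rewrite distrC; lra.
  move: hk (normr_ge0 (k - 1)); move: `|k - 1| => d hd d0 dk.
  have : (1 + 6 * d) * (1 - d) ^+ 2 <= (1 + 6 * d) * k ^+ 2.
    by rewrite ler_wpM2l ?lerXn2r ?nnegrE//; lra.
  apply: le_trans.
  (* [(1 + 6 * d) * (1 - d) ^+ 2 - 1] factors as [6 * d * (1/2 - d) * (4/3 - d)]; this ties the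
     constant 6 to the threshold 1/2. *)
  have : 0 <= d * ((1/2 - d) * (4/3 - d)) by rewrite !mulr_ge0 ?subr_ge0//; lra.
  by lra.
pose T := Num.max 1 (expR (6 * S) * r m).
exists m, T; split=> [|n mn]; first by rewrite le_max lexx.
rewrite -ler_pdivrMr// le_max; apply/orP; right.
apply: (le_trans (forward_growth K0 (fun n _ => ltW (r0 n)) rK mn)).
rewrite ler_wpM2r ?(ltW (r0 _))// ler_expR -mulr_sumr ler_pM2l//.
have := hS m.+1 n.+1; rewrite big_add1; exact: le_trans.
Qed.

(** Carleman's condition enters the estimate here: if [a n * y n] stayed above [d] from [m] on, [y]
    would dominate the divergent series of [d / a n]. *)
Lemma sum_quotient_unbounded (y : nat -> R) (A d : R) (m : nat) : 0 < d ->
  (forall n, \sum_(m <= i < n) y i <= A) ->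
  exists n, (m <= n)%N /\ a n * y n <= d.
Proof.
move=> d0 hA; apply: contrapT => /forallNP H.
have hy n : (m <= n)%N -> d / a n <= y n.
  move=> mn; rewrite ler_pdivrMr// mulrC leNgt; apply/negP => /ltW hh.
  exact: (H n).
have av0 n : 0 <= (a n)^-1 by rewrite invr_ge0 ltW.
have [n [mn]] := nneseries_pinfty_unbounded av0 carleman m (A / d).
rewrite ltNge => /negP; apply; rewrite ler_pdivlMr// mulrC mulr_sumr.
apply: le_trans (hA n); rewrite big_nat_cond [leRHS]big_nat_cond.
by apply: ler_sum => i /andP[/andP[mi _] _]; exact: hy.
Qed.

(** [f] is the residual [(J - l) x], [A] stands for the squared norm of [x] and [e] for the relative
    size of the residual. Real sequences suffice because the matrix is real: the real part of a
    complex approximate eigenvector qualifies. *)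
Definition l2_eps_solution (l e A : R) (x f : nat -> R) :=
  [/\ forall n, \sum_(0 <= i < n) x i ^+ 2 <= A,
      forall n, \sum_(0 <= i < n) f i ^+ 2 <= e ^+ 2 * A &
      forall n, f n.+1 = a n * x n + (b n.+1 - l) * x n.+1 + a n.+1 * x n.+2].

Let sum_shift (x : nat -> R) A p m n :
  (forall n, \sum_(0 <= i < n) x i ^+ 2 <= A) ->
  \sum_(m <= i < n) x (i + p)%N ^+ 2 <= A.
Proof.
move=> hA; have A0 : 0 <= A by have := hA 0%N; rewrite big_geq.
have [nm|/ltnW mn] := leqP n m; first by rewrite big_geq.
have -> : \sum_(m <= i < n) x (i + p)%N ^+ 2 =
    \sum_(m + p <= i < n + p) x i ^+ 2.
  by rewrite big_addn addnK.
apply: le_trans (hA (n + p)%N).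
have mnp : (m + p <= n + p)%N by rewrite leq_add2r.
rewrite [leRHS](big_cat_nat (leq0n _) mnp)/= lerDr.
by apply: sumr_ge0 => i _; exact: sqr_ge0.
Qed.

(** Since [a] tends to infinity, [alpha_n] tends to 0, so the spectral parameter perturbs [beta_n]
    less and less, uniformly in [|l| <= M]. *)
Lemma gamma_eventually_le M : 0 <= M -> exists m rho, rho < 1 /\
  forall n l, (m <= n)%N -> `|l| <= M ->
    `|jacobi_beta am a b n + l * jacobi_alpha am a n| <= rho.
Proof.
move=> M0; pose d := (1 - `|beta_oo|) / 4.
have d0 : 0 < d by rewrite divr_gt0// subr_gt0.
have d1 : `|beta_oo| + 2 * d < 1.
  by move: beta_oo_lt1; rewrite /d; move: `|beta_oo| => t ht; lra.
clearbody d.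
move/cvgrPdist_le : beta_cvg => /(_ d d0)[m1 _ hm1].
pose B := M / (2 * d) + 1.
have B0 : 0 < B by rewrite ltr_wpDl// divr_ge0// mulr_ge0// ltW.
have MB : M <= 2 * d * B.
  have -> : 2 * d * B = M + 2 * d by rewrite /B; field; rewrite gt_eqF.
  by rewrite lerDl mulr_ge0// ltW.
clearbody B.
move/cvgryPge : a_cvg => /(_ B)[m2 _ hm2].
(* One [d] is for the distance of [beta_n] from its limit, the other for [l * alpha_n]. The
   successor of [m2] is there because [alpha_n] involves [a] at [n - 1]. *)
exists (maxn m1 m2.+1), (`|beta_oo| + 2 * d); split=> //.
case=> [|n] l; first by rewrite geq_max ltn0 andbF.
rewrite geq_max ltnS => /andP[mn1 mn2] lM.
apply: (le_trans (ler_normD _ _)).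
have hb : `|jacobi_beta am a b n.+1| <= `|beta_oo| + d.
  have /= := hm1 _ mn1.
  have := ler_normB beta_oo (beta_oo - jacobi_beta am a b n.+1).
  by rewrite subKr; lra.
have hs : B <= s n * s n.+1.
  have ss0 : 0 <= s n * s n.+1 by rewrite mulr_ge0 ?ltW.
  rewrite -(@ler_pXn2r _ 2) ?nnegrE ?(ltW B0)// exprMn !s2 expr2.
  by apply: ler_pM; rewrite ?(ltW B0)//; [exact: hm2 | exact: hm2 (leqW mn2)].
have ha : `|l * jacobi_alpha am a n.+1| <= d.
  have ss0 : 0 < 2 * (s n * s n.+1) by rewrite !mulr_gt0.
  rewrite normrM alphaE normrM normr1 mul1r normfV (gtr0_norm ss0).
  rewrite ler_pdivrMr//; apply: (le_trans lM); apply: (le_trans MB).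
  by rewrite mulrCA -mulrA !ler_pM2l.
by lra.
Qed.

(** From [m0] on, the ratio bound [T], the bound [rho] on [g] and [K <= 1 / 2] hold together, so the
    energy step applies at every index. *)
Lemma eps_solution_bound_eventually M : 0 <= M ->
  exists m0, forall m, (m0 <= m)%N -> exists C : R, 0 <= C /\
       forall (l e A : R) (x f : nat -> R), `|l| <= M -> 0 < e ->
      l2_eps_solution l e A x f -> x m ^+ 2 <= C * (e * A).
Proof.
move=> M0.
have [m1 [T [T1 hT]]] := jacobi_ratio_bounded.
have [m2 [rho [rho1 hrho]]] := gamma_eventually_le M0.
have [Sk hSk] := in_l1_bounded k_l1.
have [Sb hSb] := in_l1_bounded beta_l1.
have [Sa hSa] := in_l1_bounded alpha_l1.
have r0 : 0 < 1 - rho by rewrite subr_gt0.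
pose K n := (2 * `|jacobi_k am a n.+1 - 1| +
  (`|telescope (jacobi_beta am a b) n| +
   M * `|telescope (jacobi_alpha am a) n|)) / (1 - rho).
have K0 n : 0 <= K n.
  by rewrite divr_ge0 ?(ltW r0)// !addr_ge0 ?mulr_ge0.
pose SK := (2 * Sk + (Sb + M * Sa)) / (1 - rho).
have hSK m n : \sum_(m <= i < n) K i <= SK.
  rewrite -mulr_suml ler_pM2r ?invr_gt0// !big_split/= -!mulr_sumr.
  apply: lerD; last by apply: lerD => //; exact: ler_wpM2l.
  by rewrite ler_pM2l//; have := hSk m.+1 n.+1; rewrite big_add1.
(* The numerator of [K] will be at most [4 * c]: twice [c] from [k - 1], once from the differences
   of [beta], once from [M] times those of [alpha]. *)
pose c := (1 - rho) / 8.
have c0 : 0 < c by rewrite divr_gt0.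
have [m3 _ hm3] := k_near c0.
have M10 : 0 < M + 1 by lra.
have [m4 _ hm4] : \forall i \near \oo, `|telescope (jacobi_beta am a b) i| <= c.
  have /cvgrPdist_le /(_ _ c0) := in_l1_cvg0 beta_l1.
  by apply: filterS => i; rewrite sub0r normrN.
have [m5 _ hm5] : \forall i \near \oo,
    `|telescope (jacobi_alpha am a) i| <= c / (M + 1).
  have /cvgrPdist_le /(_ (c / (M + 1))) := in_l1_cvg0 alpha_l1.
  by move=> /(_ (divr_gt0 c0 M10)); apply: filterS => i; rewrite sub0r normrN.
have K2 j : (maxn m3 (maxn m4 m5) <= j)%N -> K j <= 1 / 2.
  rewrite !geq_max => /and3P[h3 h4 h5]; rewrite /K ler_pdivrMr//.
  have /= := hm3 _ (leqW h3); have /= := hm4 _ h4; have /= := hm5 _ h5.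
  rewrite ler_pdivlMr// mulrDr mulr1 mulrC.
  have := normr_ge0 (telescope (jacobi_alpha am a) j).
  by rewrite /c; lra.
pose P := expR (4 * SK).
have P0 : 0 < P by exact: expR_gt0.
exists (maxn m1 (maxn m2 (maxn m3 (maxn m4 m5)))); move=> m.
rewrite geq_max => /andP[mm1]; rewrite geq_max => /andP[mm2 mm3].
exists (P * (4 * T) / (a m * (1 - rho))); split.
  by rewrite divr_ge0 ?mulr_ge0 ?(ltW P0) ?(ltW r0) ?(ltW (a_gt0 m))//; lra.
move=> l e A x f lM e0 [hx hf eqn].
have A0 : 0 <= A by have := hx 0%N; rewrite big_geq.
pose v n := s n * x n.
pose g n := jacobi_beta am a b n + l * jacobi_alpha am a n.
pose G n := energy (g n) (v n) (v n.+1).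
(* The source term is split by the inequality of means with weight [e]. As the squares of [f] sum to
   at most [e ^+ 2 * A], both halves have order [e * A], which makes the final bound linear in
   [e]. *)
pose h n := T * (2 / e * f (n + 1)%N ^+ 2 +
                 (e * x (n + 2)%N ^+ 2 + e * x (n + 0)%N ^+ 2)).
have T0 : 0 < T by lra.
have h0 n : 0 <= h n.
  rewrite mulr_ge0 ?(ltW T0)// !addr_ge0// mulr_ge0 ?sqr_ge0 ?(ltW e0)//.
  by rewrite divr_ge0// ltW.
have hG n : (m <= n)%N -> (1 - rho) * (v n ^+ 2 + v n.+1 ^+ 2) <= G n.
  by move=> mn; apply: energy_ge; apply: hrho => //; exact: leq_trans mn.
have G0 n : (m <= n)%N -> 0 <= G n.
  move=> mn; apply: le_trans (hG _ mn).
  by rewrite mulr_ge0 ?(ltW r0)// addr_ge0 ?sqr_ge0.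
have hs2 n : (m <= n)%N -> s n.+2 <= T * s n.
  move=> mn; have ts0 : 0 <= T * s n by rewrite mulr_ge0 ?ltW.
  rewrite -(@ler_pXn2r _ 2) ?nnegrE ?(ltW (s_gt0 _))// exprMn !s2.
  apply: (@le_trans _ _ (T * a n.+1)).
    by apply: hT; rewrite (leq_trans mm1)// leqW.
  by rewrite expr2 -mulrA ler_pM2l// hT// (leq_trans mm1).
have hh n : (m <= n)%N ->
    2 * (`|f n.+1 / s n| * (`|v n.+2| + `|v n|)) <= h n.
  move=> mn.
  have q (y z : R) : 2 * (`|y| * `|z|) <= 1 / e * y ^+ 2 + e * z ^+ 2.
    rewrite -(real_normK (num_real y)) -(real_normK (num_real z)).
    rewrite -(@ler_pM2l _ e)// -subr_ge0.
    have -> : e * (1 / e * `|y| ^+ 2 + e * `|z| ^+ 2) -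
        e * (2 * (`|y| * `|z|)) = (`|y| - e * `|z|) ^+ 2 by field; rewrite gt_eqF.
    exact: sqr_ge0.
  rewrite /v !normrM normfV !(gtr0_norm (s_gt0 _)).
  have -> : `|f n.+1| / s n * (s n.+2 * `|x n.+2| + s n * `|x n|) =
      `|f n.+1| * (s n.+2 / s n * `|x n.+2| + `|x n|).
    by field; rewrite gt_eqF.
  have st : s n.+2 / s n <= T by rewrite ler_pdivrMr// hs2.
  have : `|f n.+1| * (s n.+2 / s n * `|x n.+2| + `|x n|) <=
      T * (`|f n.+1| * `|x n.+2| + `|f n.+1| * `|x n|).
    rewrite -mulrDr mulrCA ler_wpM2l// mulrDr lerD//.
      by rewrite ler_wpM2r.
    by rewrite ler_peMl.
  have := q (f n.+1) (x n.+2); have := q (f n.+1) (x n).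
  rewrite /h addn0 addn1 addn2.
  move: (`|f n.+1| * `|x n.+2|) (`|f n.+1| * `|x n|) => p1 p2 q1 q2 q3.
  apply: (@le_trans _ _ (T * (2 * p1 + 2 * p2))); first by lra.
  by rewrite ler_pM2l//; move: q1 q2; rewrite -[2 / e]mulr1 mulrAC; lra.
have hstep n : (m <= n)%N -> G n <= (1 + 4 * K n) * G n.+1 + h n.
  move=> mn.
  have gd : `|g n.+1 - g n| <= `|telescope (jacobi_beta am a b) n| +
      M * `|telescope (jacobi_alpha am a) n|.
    have -> : g n.+1 - g n = telescope (jacobi_beta am a b) n +
        l * telescope (jacobi_alpha am a) n by rewrite /telescope /g /=; ring.
    apply: (le_trans (ler_normD _ _)); rewrite lerD2l normrM.
    by rewrite ler_wpM2r.
  pose k := jacobi_k am a n.+1.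
  have KK : (2 * `|k - 1| + `|g n.+1 - g n|) / (1 - rho) <= K n.
    by rewrite ler_pM2r ?invr_gt0// lerD2l.
  have eqv : v n - 2 * g n.+1 * v n.+1 + k * v n.+2 = f n.+1 / s n.
    rewrite eqn /v /g /k kE alphaE betaE -!s2.
    by field; rewrite !gt_eqF.
  have gm i : (m <= i)%N -> `|g i| <= rho.
    by move=> mi; apply: hrho => //; exact: leq_trans mi.
  have := energy_backward rho1 (gm n mn) (gm _ (leqW mn)) eqv.
  move=> /(_ (le_trans KK (K2 _ (leq_trans mm3 mn)))).
  move=> /le_trans; apply; rewrite lerD ?hh//.
  by rewrite ler_wpM2r ?lerD2l ?ler_pM2l// G0// leqW.
have sumh n : \sum_(m <= i < n) h i <= 4 * T * (e * A).
  have -> : 4 * T * (e * A) = T * (4 * (e * A)) by ring.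
  rewrite -mulr_sumr ler_pM2l// !big_split/= -!mulr_sumr.
  have := ler_wpM2l (ltW e0) (sum_shift 2 m n hx).
  have := ler_wpM2l (ltW e0) (sum_shift 0 m n hx).
  have e2 : 0 <= 2 / e by rewrite divr_ge0// ltW.
  have := ler_wpM2l e2 (sum_shift 1 m n hf).
  have -> : 2 / e * (e ^+ 2 * A) = 2 * (e * A) by field; rewrite gt_eqF.
  by lra.
have am0 : 0 < a m * (1 - rho) by rewrite mulr_gt0.
(* The energy at a far index is only arbitrarily small, so the bound is proved up to [d]; [d'] is
   [d] rescaled by the factors from Gronwall and from the lower bound of the energy. *)
apply/ler_addgt0Pr => d d0.
pose d' := d * (a m * (1 - rho)) / P.
have d'0 : 0 < d' by rewrite divr_gt0 ?mulr_gt0.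
(* As [a n.+1 <= T * a n], the product [a n * y n] dominates the energy at [n], while the sums of
   [y] stay bounded. *)
pose y n := 2 * (x (n + 0)%N ^+ 2 + T * x (n + 1)%N ^+ 2).
have sumy n : \sum_(m <= i < n) y i <= 2 * (A + T * A).
  rewrite -mulr_sumr ler_pM2l// big_split/= -mulr_sumr.
  by rewrite lerD ?ler_pM2l// sum_shift.
have [N [mN hN]] := sum_quotient_unbounded d'0 sumy.
have GN : G N <= d'.
  apply: le_trans hN; apply: (le_trans (energy_le _ _ _)).
    by apply: le_trans (ltW rho1); apply: hrho => //; exact: leq_trans mN.
  have -> : a N * y N = 2 * (a N * x N ^+ 2 + T * a N * x N.+1 ^+ 2).
    by rewrite /y addn0 addn1; ring.
  rewrite /v !exprMn !s2 ler_pM2l// lerD2l ler_wpM2r ?sqr_ge0//.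
  by rewrite hT// (leq_trans mm1).
have K40 n : 0 <= 4 * K n by rewrite mulr_ge0.
have := backward_gronwall K40 h0 G0 hstep mN.
have : expR (\sum_(m <= i < N) 4 * K i) <= P.
  by rewrite ler_expR -mulr_sumr ler_pM2l.
have hGm : a m * (1 - rho) * x m ^+ 2 <= G m.
  apply: le_trans (hG _ (leqnn m)); rewrite [a m * _]mulrC -mulrA ler_pM2l//.
  by rewrite /v exprMn s2 lerDl sqr_ge0.
move=> hP hGr.
have : G m <= P * (d' + 4 * T * (e * A)).
  apply: (le_trans hGr); apply: ler_pM => //.
  - by rewrite addr_ge0 ?G0// sumr_ge0.
  - exact: lerD.
move=> /(le_trans hGm) hfin.
rewrite -(@ler_pM2l _ (a m * (1 - rho)))//; apply: (le_trans hfin).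
rewrite /d' le_eqVlt; apply/orP; left; apply/eqP.
by field; rewrite !gt_eqF.
Qed.

(** Below [m0], row [m + 1] of the recurrence is solved for [x m], which carries the bound down from
    [m + 1] and [m + 2]. There [e <= 1] turns the residual bound [e ^+ 2 * A] into [e * A]. *)
Lemma eps_solution_bound M m : 0 <= M ->
  exists C : R, 0 <= C /\
       forall (l e A : R) (x f : nat -> R), `|l| <= M -> 0 < e -> e <= 1 ->
      l2_eps_solution l e A x f -> x m ^+ 2 <= C * (e * A).
Proof.
move=> M0; have [m0 hm0] := eps_solution_bound_eventually M0.
pose Q m := exists C : R, 0 <= C /\
       forall (l e A : R) (x f : nat -> R), `|l| <= M -> 0 < e -> e <= 1 ->
      l2_eps_solution l e A x f -> x m ^+ 2 <= C * (e * A).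
rewrite -/(Q m).
suff H n : forall m, (m0 <= m + n)%N -> Q m by apply: (H m0); rewrite leq_addl.
elim: n => [|n IH] {}m.
  rewrite addn0 => /hm0[C [C0 hC]]; exists C; split=> // l e A x f lM e0 _.
  exact: hC.
move=> hmn.
have [C1 [C10 hC1]] : Q m.+1 by apply: IH; rewrite addSnnS.
have [C2 [C20 hC2]] : Q m.+2 by apply: IH; rewrite !addSn -addnS leqW.
pose B := `|b m.+1| + M.
exists (3 * (1 + B ^+ 2 * C1 + a m.+1 ^+ 2 * C2) / a m ^+ 2); split.
  have p1 : 0 <= B ^+ 2 * C1 by rewrite mulr_ge0 ?sqr_ge0.
  have p2 : 0 <= a m.+1 ^+ 2 * C2 by rewrite mulr_ge0 ?sqr_ge0.
  by rewrite divr_ge0 ?sqr_ge0// mulr_ge0// !addr_ge0.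
move=> l e A x f lM e0 e1 sol.
have h1 := hC1 _ _ _ _ _ lM e0 e1 sol; have h2 := hC2 _ _ _ _ _ lM e0 e1 sol.
case: sol => hx hf eqn.
have A0 : 0 <= A by have := hx 0%N; rewrite big_geq.
have hfm : f m.+1 ^+ 2 <= e * A.
  have : f m.+1 ^+ 2 <= e ^+ 2 * A.
    apply: le_trans (hf m.+2); rewrite big_nat_recr//= lerDr.
    by apply: sumr_ge0 => i _; exact: sqr_ge0.
  by move/le_trans; apply; rewrite expr2 -mulrA ler_piMl// mulr_ge0// ltW.
have bB : (b m.+1 - l) ^+ 2 <= B ^+ 2.
  rewrite -(real_normK (num_real _)) lerXn2r ?nnegrE ?addr_ge0//.
  by apply: (le_trans (ler_normB _ _)); rewrite lerD2l.
rewrite mulrAC ler_pdivlMr ?exprn_gt0// mulrC -exprMn.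
have -> : a m * x m = f m.+1 - (b m.+1 - l) * x m.+1 - a m.+1 * x m.+2.
  by rewrite eqn; ring.
have h3 : ((b m.+1 - l) * x m.+1) ^+ 2 <= B ^+ 2 * (C1 * (e * A)).
  by rewrite exprMn ler_pM ?sqr_ge0.
have h4 : (a m.+1 * x m.+2) ^+ 2 <= a m.+1 ^+ 2 * (C2 * (e * A)).
  by rewrite exprMn ler_pM ?sqr_ge0.
move: hfm h3 h4; move: (f _) (_ * x _) (_ * x _) => p q r hp hq hr.
have := sqr_ge0 (p + q); have := sqr_ge0 (p + r); have := sqr_ge0 (q - r).
by nra.
Qed.

End a_priori_estimate.

(** * Real structure of l2 *)

Local Notation Re := complex.Re.
Local Notation Im := complex.Im.

Section l2_real_structure.
Variable R : realType.
Implicit Types (z : R[i]) (u v w : l2 R).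

Lemma sqr_normcE z : normc z ^+ 2 = Re z ^+ 2 + Im z ^+ 2.
Proof. by case: z => x y /=; rewrite sqr_sqrtr// addr_ge0 ?sqr_ge0. Qed.

Lemma cvg_complex (x y : nat -> R) (l m : R) :
  x @ \oo --> l -> y @ \oo --> m ->
  (fun n => x n +i* y n : R[i]^o) @ \oo --> (l +i* m : R[i]^o).
Proof.
move=> /cvgrPdist_lt hx /cvgrPdist_lt hy; apply/cvgrPdist_lt => -[e e'].
(* Positivity in [R[i]] forces the imaginary part of the radius to be 0. *)
rewrite ltcE/= => /andP[/eqP -> e0].
have e2 : 0 < e / 2 by rewrite divr_gt0.
have := hy _ e2; have := hx _ e2; apply: filterS2 => n h1 h2.
rewrite normc_def ltcR /=.
apply: (@le_lt_trans _ _ (`|l - x n| + `|m - y n|)); last by lra.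
rewrite -(@ler_pXn2r _ 2) ?nnegrE ?sqrtr_ge0 ?addr_ge0//.
rewrite sqr_sqrtr ?addr_ge0 ?sqr_ge0//.
rewrite -(real_normK (num_real (l - _))) -(real_normK (num_real (m - _))).
have : 0 <= `|l - x n| * `|m - y n| by rewrite mulr_ge0.
by lra.
Qed.

Lemma sqnorm2_le (z : nat -> R[i]^o) (B : R) :
  (forall n, \sum_(0 <= i < n) normc (z i) ^+ 2 <= B) -> (sqnorm2 z <= B%:E)%E.
Proof.
move=> hB; apply: lime_le.
  by apply: is_cvg_nneseries => i _ _; rewrite lee_fin sqr_ge0.
by apply: nearW => n; rewrite sumEFin lee_fin.
Qed.

Lemma in_l2_of_bounded (z : nat -> R[i]^o) (B : R) :
  (forall n, \sum_(0 <= i < n) normc (z i) ^+ 2 <= B) -> z \in in_l2 R.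
Proof.
by move=> /sqnorm2_le hB; rewrite unfold_in; exact: le_lt_trans hB (ltry _).
Qed.

Definition nrm2 u : R := fine (sqnorm2 u).

Lemma nrm2E u : sqnorm2 u = (nrm2 u)%:E.
Proof.
rewrite /nrm2 fineK// ge0_fin_numE ?sqnorm2_ge0//.
by have := l2P u; rewrite unfold_in.
Qed.

Lemma nrm2_ge0 u : 0 <= nrm2 u.
Proof. by rewrite fine_ge0// sqnorm2_ge0. Qed.

Lemma sum_le_nrm2 u n : \sum_(0 <= i < n) normc (u i) ^+ 2 <= nrm2 u.
Proof.
rewrite -lee_fin -nrm2E -sumEFin; apply: nneseries_lim_ge => i _ _.
by rewrite lee_fin sqr_ge0.
Qed.

Lemma nrm2_le u (B : R) :
  (forall n, \sum_(0 <= i < n) normc (u i) ^+ 2 <= B) -> nrm2 u <= B.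
Proof. by move=> /sqnorm2_le; rewrite nrm2E lee_fin. Qed.

Lemma sqr_coord_le_nrm2 u n : normc (u n) ^+ 2 <= nrm2 u.
Proof.
apply: le_trans (sum_le_nrm2 u n.+1); rewrite big_nat_recr//= lerDr.
by apply: sumr_ge0 => i _; exact: sqr_ge0.
Qed.

Definition rip_term (x y : R[i]) : R := Re x * Re y + Im x * Im y.

(** The real part of [inner], treated as a symmetric real bilinear form; pairing with [i v] recovers
    the imaginary part in [innerE]. *)
Definition rip u v : R := limn (series (fun n => rip_term (u n) (v n))).

Lemma rip_term_le (x y : R[i]) : `|rip_term x y| <= normc x ^+ 2 + normc y ^+ 2.
Proof.
rewrite /rip_term !sqr_normcE ler_norml.
have := sqr_ge0 (Re x + Re y); have := sqr_ge0 (Im x + Im y).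
have := sqr_ge0 (Re x - Re y); have := sqr_ge0 (Im x - Im y).
have := sqr_ge0 (Re x); have := sqr_ge0 (Im x).
have := sqr_ge0 (Re y); have := sqr_ge0 (Im y).
by move=> *; apply/andP; split; lra.
Qed.

Lemma is_cvg_rip u v : cvgn (series (fun n => rip_term (u n) (v n))).
Proof.
apply: normed_cvg; apply: nondecreasing_is_cvgn.
  apply/nondecreasing_seqP => n.
  by rewrite /normed_series_of /series /= big_nat_recr//= lerDl normr_ge0.
exists (nrm2 u + nrm2 v) => _ [n _ <-].
apply: (@le_trans _ _
  (\sum_(0 <= i < n) (normc (u i) ^+ 2 + normc (v i) ^+ 2))).
  by apply: ler_sum => i _; exact: rip_term_le.
by rewrite big_split/= lerD// sum_le_nrm2.
Qed.

Lemma cvg_rip u v : series (fun n => rip_term (u n) (v n)) @ \oo --> rip u v.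
Proof. exact: is_cvg_rip. Qed.

Lemma rip_unique u v l :
  series (fun n => rip_term (u n) (v n)) @ \oo --> l -> rip u v = l.
Proof. by move=> h; exact: cvg_lim h. Qed.

Lemma ripC u v : rip u v = rip v u.
Proof.
by rewrite /rip; congr (limn (series _)); apply/funext => n;
  rewrite /rip_term; ring.
Qed.

Lemma ripDl u v w : rip (u + v) w = rip u w + rip v w.
Proof.
apply: rip_unique.
rewrite (_ : series _ = series (fun n => rip_term (u n) (w n)) +
    series (fun n => rip_term (v n) (w n))).
  by apply: cvgD; exact: cvg_rip.
rewrite -seriesD; congr series; apply/funext => n.
have -> : (u + v) n = u n + v n by [].
by rewrite fctE /rip_term; case: (u n) (v n) => x y [x' y'] /=; ring.
Qed.

Lemma ripZl (c : R) u v : rip (c%:C *: u) v = c * rip u v.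
Proof.
apply: rip_unique.
rewrite (_ : series _ = cst c * series (fun n => rip_term (u n) (v n))).
  by apply: cvgM; [exact: cvg_cst|exact: cvg_rip].
apply/funext => N; rewrite fctE /series /= mulr_sumr; apply: eq_bigr => n _.
rewrite -[LHS]/(rip_term (c%:C * u n) (v n)) /rip_term.
by case: (u n) => x y /=; ring.
Qed.

Lemma ripNl u v : rip (- u) v = - rip u v.
Proof.
have -> : - u = (-1)%:C *: u by rewrite (rmorphN1 (real_complex R)) scaleN1r.
by rewrite ripZl mulN1r.
Qed.

Lemma ripBl u v w : rip (u - v) w = rip u w - rip v w.
Proof. by rewrite ripDl ripNl. Qed.

Lemma ripDr u v w : rip w (u + v) = rip w u + rip w v.
Proof. by rewrite !(ripC w) ripDl. Qed.

Lemma ripNr u v : rip u (- v) = - rip u v.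
Proof. by rewrite !(ripC u) ripNl. Qed.

Lemma ripBr u v w : rip w (u - v) = rip w u - rip w v.
Proof. by rewrite !(ripC w) ripBl. Qed.

Lemma ripZr (c : R) u v : rip u (c%:C *: v) = c * rip u v.
Proof. by rewrite !(ripC u) ripZl. Qed.

Lemma rip_nrm2 u : rip u u = nrm2 u.
Proof.
have : (fun n => (\sum_(0 <= i < n) (normc (u i) ^+ 2)%:E)%E) @ \oo -->
    (nrm2 u)%:E.
  rewrite -nrm2E.
  by apply: is_cvg_nneseries => i _ _; rewrite lee_fin sqr_ge0.
move/fine_cvg => h; apply: rip_unique.
rewrite (_ : series _ = fine \o
  (fun n => (\sum_(0 <= i < n) (normc (u i) ^+ 2)%:E)%E))//.
apply/funext => n /=; rewrite sumEFin /series /=.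
by apply: eq_bigr => i _; rewrite sqr_normcE /rip_term; ring.
Qed.

Lemma rip0r u : rip u 0 = 0.
Proof. by apply: (addrI (rip u 0)); rewrite -ripDr !addr0. Qed.

Lemma nrm20 : nrm2 (0 : l2 R) = 0.
Proof. by rewrite -rip_nrm2 rip0r. Qed.

Lemma nrm2D u v : nrm2 (u + v) = nrm2 u + 2 * rip u v + nrm2 v.
Proof. by rewrite -!rip_nrm2 ripDl !ripDr (ripC v u); ring. Qed.

Lemma nrm2B u v : nrm2 (u - v) = nrm2 u - 2 * rip u v + nrm2 v.
Proof. by rewrite -!rip_nrm2 ripBl !ripBr (ripC v u); ring. Qed.

Lemma nrm2Z (c : R) u : nrm2 (c%:C *: u) = c ^+ 2 * nrm2 u.
Proof. by rewrite -!rip_nrm2 ripZl ripZr; ring. Qed.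

(** A weighted Cauchy-Schwarz inequality free of square roots, from the squared norms of [t u + v]
    and [t u - v] being nonnegative. *)
Lemma rip_le (t : R) u v : 0 < t -> `|rip u v| <= t * nrm2 u + nrm2 v / t.
Proof.
move=> t0; have h1 := nrm2_ge0 (t%:C *: u + v).
have h2 := nrm2_ge0 (t%:C *: u - v).
have h3 := nrm2_ge0 u; have h4 := nrm2_ge0 v.
move: h1 h2; rewrite nrm2D nrm2B nrm2Z ripZl => h1 h2.
rewrite -(@ler_pM2l _ t)// mulrDr [t * (_ / t)]mulrC divfK ?gt_eqF//.
rewrite -{1}(gtr0_norm t0) -normrM ler_norml.
have : 0 <= t * (t * nrm2 u) by rewrite !mulr_ge0// ltW.
by move=> h5; apply/andP; split; lra.
Qed.

Lemma innerE u v : inner u v = rip u v +i* rip u ((0 +i* 1) *: v).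
Proof.
rewrite /inner; apply: (@cvg_lim R[i]^o); first exact: norm_hausdorff.
rewrite (_ : series _ = fun n =>
  (series (fun n => rip_term (u n) (v n)) n) +i*
  (series (fun n => rip_term (u n) (((0 +i* 1) *: v : l2 R) n)) n)).
  by apply: cvg_complex; exact: cvg_rip.
have E n : u n * (v n)^* =
    rip_term (u n) (v n) +i* rip_term (u n) ((0 +i* 1) * v n).
  case: (u n) (v n) => x y [x' y']; rewrite /rip_term /=.
  by apply/eqP; rewrite eq_complex /=; apply/andP; split; apply/eqP; ring.
apply/funext => n; rewrite /series /=.
elim: n => [|n IH]; first by rewrite !big_geq.
by rewrite !big_nat_recr// IH; exact: (congr1 (fun z : R[i] => _ + z) (E n)).
Qed.

Lemma Re_inner u v : Re (inner u v) = rip u v.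
Proof. by rewrite innerE. Qed.

Lemma sum_nat_zero_tail (F : nat -> R) N n :
  (forall i, (N <= i)%N -> F i = 0) -> (N <= n)%N ->
  \sum_(0 <= i < n) F i = \sum_(0 <= i < N) F i.
Proof.
move=> hF Nn; rewrite (big_cat_nat (leq0n N) Nn) /= -[RHS]addr0; congr (_ + _).
by rewrite big_nat_cond big1// => i /andP[/andP[Ni _] _]; exact: hF.
Qed.

Lemma sum_nat_zero_head (F G : nat -> R) N n :
  (forall i, (i < N)%N -> F i = 0) -> (forall i, (N <= i)%N -> F i = G i) ->
  \sum_(0 <= i < n) F i <= \sum_(N <= i < n) G i.
Proof.
move=> F0 FG; have [nN|/ltnW Nn] := leqP n N.
  rewrite [leRHS]big_geq// big_nat_cond big1// => i /andP[/andP[_ hi] _].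
  by rewrite F0// (leq_trans hi).
rewrite (big_cat_nat (leq0n N) Nn) /= -[leRHS]add0r lerD//.
  by rewrite big_nat_cond big1// => i /andP[/andP[_ hi] _]; exact: F0.
by rewrite le_eqVlt (eq_big_nat _ _ (F2 := G)) ?eqxx// => i /andP[/FG].
Qed.

Lemma rip_finite u v N : (forall n, (N <= n)%N -> u n = 0) ->
  rip u v = \sum_(0 <= i < N) rip_term (u i) (v i).
Proof.
move=> hu; apply: rip_unique; apply: cvg_near_cst.
exists N => // n /= Nn; apply: sum_nat_zero_tail => // i Ni.
by rewrite hu// /rip_term /= !mul0r addr0.
Qed.

Lemma in_l2_finite (z : nat -> R[i]^o) N : (forall n, (N <= n)%N -> z n = 0) ->
  z \in in_l2 R.
Proof.
move=> hz; apply: (@in_l2_of_bounded _ (\sum_(0 <= i < N) normc (z i) ^+ 2)).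
move=> n; have [nN|/ltnW Nn] := leqP n N.
  rewrite [leRHS](big_cat_nat (leq0n n) nN) /= lerDl.
  by apply: sumr_ge0 => i _; exact: sqr_ge0.
rewrite (sum_nat_zero_tail _ Nn)// => i Ni.
by rewrite hz// [normc _]normc0 expr0n.
Qed.

Definition trunc N (z : nat -> R[i]^o) (n : nat) : R[i]^o :=
  if (n < N)%N then z n else 0.

Lemma trunc_in_l2 N (z : nat -> R[i]^o) : trunc N z \in in_l2 R.
Proof. by apply: (@in_l2_finite _ N) => n; rewrite /trunc ltnNge => ->. Qed.

Definition l2_trunc N (z : nat -> R[i]^o) : l2 R := L2 (trunc_in_l2 N z).

Lemma l2_tail u e : 0 < e ->
  exists N, forall n, \sum_(N <= i < n) normc (u i) ^+ 2 <= e.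
Proof.
move=> e0; have := @cvg_rip u u; rewrite rip_nrm2.
move/cvgrPdist_le => /(_ e e0)[N _ hN]; exists N => n.
have [nN|/ltnW Nn] := leqP n N; first by rewrite big_geq// ltW.
have := hN N (leqnn N); rewrite /series /= => /(le_trans (ler_norm _)).
have := sum_le_nrm2 u n; rewrite (big_cat_nat (leq0n N) Nn) /=.
have -> : \sum_(0 <= i < N) rip_term (u i) (u i) =
    \sum_(0 <= i < N) normc (u i) ^+ 2.
  by apply: eq_bigr => i _; rewrite sqr_normcE /rip_term; ring.
by lra.
Qed.

End l2_real_structure.

(** * Self-adjointness *)

Section jacobi_operator.
Variables (R : realType) (a b : nat -> R).
Implicit Types (x y : nat -> R) (z w : nat -> R[i]^o) (u v f g : l2 R).

Definition real_jacobi_action x n : R :=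
  (if n is m.+1 then a m * x m else 0) + b n * x n + a n * x n.+1.

Lemma Re_jacobi_action z n :
  Re (jacobi_action a b z n) = real_jacobi_action (fun n => Re (z n)) n.
Proof.
rewrite /jacobi_action /real_jacobi_action; case: n => [|n].
  by case: (z 0) (z 1) => p q [r s] /=; ring.
by case: (z n) (z n.+1) (z n.+2) => p q [r s] [t k] /=; ring.
Qed.

Lemma Im_jacobi_action z n :
  Im (jacobi_action a b z n) = real_jacobi_action (fun n => Im (z n)) n.
Proof.
rewrite /jacobi_action /real_jacobi_action; case: n => [|n].
  by case: (z 0) (z 1) => p q [r s] /=; ring.
by case: (z n) (z n.+1) (z n.+2) => p q [r s] [t k] /=; ring.
Qed.

Lemma ReB (c e : R[i]) : Re (c - e) = Re c - Re e.
Proof. by case: c e => c1 c2 []. Qed.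

Lemma ImB (c e : R[i]) : Im (c - e) = Im c - Im e.
Proof. by case: c e => c1 c2 []. Qed.

(** Green's formula: the diagonal cancels and the off-diagonal terms telescope to a Wronskian at
    [n]. *)
Lemma real_green x y n :
  \sum_(0 <= i < n.+1)
    (real_jacobi_action x i * y i - x i * real_jacobi_action y i) =
  a n * (x n.+1 * y n - x n * y n.+1).
Proof.
elim: n => [|n IH]; first by rewrite big_nat1 /real_jacobi_action; ring.
by rewrite big_nat_recr//= IH /real_jacobi_action; ring.
Qed.

Lemma green_finite z w N : (forall n, (N <= n)%N -> z n = 0) ->
  \sum_(0 <= i < N.+1) rip_term (jacobi_action a b z i) (w i) =
  \sum_(0 <= i < N.+1) rip_term (z i) (jacobi_action a b w i).
Proof.
move=> hz; apply/eqP; rewrite -subr_eq0 -sumrB; apply/eqP.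
have hR := real_green (fun n => Re (z n)) (fun n => Re (w n)) N.
have hI := real_green (fun n => Im (z n)) (fun n => Im (w n)) N.
move: hR hI; rewrite !hz//= !mul0r subrr mulr0 => hR hI.
have := congr2 +%R hR hI; rewrite addr0 -big_split /= => E; rewrite -[RHS]E.
apply: eq_bigr => i _.
by rewrite /rip_term !Re_jacobi_action !Im_jacobi_action; ring.
Qed.

Lemma jacobi_action_finite z N : (forall n, (N <= n)%N -> z n = 0) ->
  forall n, (N.+1 <= n)%N -> jacobi_action a b z n = 0.
Proof.
move=> hz [//|n]; rewrite ltnS => Nn; rewrite /jacobi_action.
by rewrite !hz ?mulr0 ?addr0// ?leqW// leqW.
Qed.

Definition jacobi_max : operator R :=
  [set p : l2 R * l2 R | forall n, p.2 n = jacobi_action a b p.1 n].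

(** Finite support of one argument kills the Wronskian whatever the other is, so only one argument
    has to be approximated in [jacobi_sym]. *)
Lemma jacobi_min_sym p q : jacobi_min a b p -> jacobi_max q ->
  rip p.2 q.1 = rip p.1 q.2.
Proof.
move=> [[N hN] hp] hq.
rewrite (@rip_finite _ p.2 _ N.+1); last first.
  by move=> n Nn; rewrite hp (jacobi_action_finite hN).
rewrite (@rip_finite _ p.1 _ N.+1); last by move=> n /ltnW; exact: hN.
transitivity (\sum_(0 <= i < N.+1) rip_term (jacobi_action a b p.1 i) (q.1 i)).
  by apply: eq_bigr => i _; rewrite hp.
by rewrite (green_finite _ hN); apply: eq_bigr => i _; rewrite hq.
Qed.

Lemma jacobi_actionB z w n :
  jacobi_action a b (z - w) n = jacobi_action a b z n - jacobi_action a b w n.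
Proof.
have E i : (z - w) i = z i - w i by [].
by rewrite /jacobi_action; case: n => [|n]; rewrite !E; ring.
Qed.

Lemma jacobi_actionD z w n :
  jacobi_action a b (z + w) n = jacobi_action a b z n + jacobi_action a b w n.
Proof.
have E i : (z + w) i = z i + w i by [].
by rewrite /jacobi_action; case: n => [|n]; rewrite !E; ring.
Qed.

Lemma jacobi_actionZ (c : R[i]) z n :
  jacobi_action a b (c *: z) n = c * jacobi_action a b z n.
Proof.
have E i : (c *: z) i = c * z i by [].
by rewrite /jacobi_action; case: n => [|n]; rewrite !E; ring.
Qed.

Lemma jacobi_maxD u f v g : jacobi_max (u, f) -> jacobi_max (v, g) ->
  jacobi_max (u + v, f + g).
Proof.
move=> h1 h2 n; rewrite [RHS]jacobi_actionD -[LHS]/(f n + g n).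
by rewrite (h1 n) (h2 n).
Qed.

Lemma jacobi_maxB u f v g : jacobi_max (u, f) -> jacobi_max (v, g) ->
  jacobi_max (u - v, f - g).
Proof.
move=> h1 h2 n; rewrite [RHS]jacobi_actionB -[LHS]/(f n - g n).
by rewrite (h1 n) (h2 n).
Qed.

Lemma jacobi_maxZ (c : R[i]) u f : jacobi_max (u, f) ->
  jacobi_max (c *: u, c *: f).
Proof.
move=> h n; rewrite [RHS]jacobi_actionZ -[LHS]/(c * f n).
by rewrite (h n).
Qed.

Lemma sqr_real_jacobi_action_le x n (B : R) :
  (forall i, x i ^+ 2 <= B) ->
  real_jacobi_action x n ^+ 2 <=
    3 * (((if n is m.+1 then a m else 0) ^+ 2 + b n ^+ 2 + a n ^+ 2) * B).
Proof.
move=> hB; rewrite /real_jacobi_action.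
have hM (c : R) i : (c * x i) ^+ 2 <= c ^+ 2 * B.
  by rewrite exprMn ler_wpM2l ?sqr_ge0.
have B0 : 0 <= B by apply: le_trans (hB 0%N); exact: sqr_ge0.
have : (if n is m.+1 then a m * x m else 0) ^+ 2 <=
    (if n is m.+1 then a m else 0) ^+ 2 * B.
  by case: n => [|n]; rewrite ?expr0n ?mul0r//=.
have := hM (b n) n; have := hM (a n) n.+1.
move: (if n is m.+1 then a m * x m else 0) (b n * x n) (a n * x n.+1) => p q r.
have := sqr_ge0 (p - q); have := sqr_ge0 (p - r); have := sqr_ge0 (q - r).
by nra.
Qed.

(** Each row of the matrix involves at most three coordinates, so the row equations survive limits
    in l2. *)
Lemma jacobi_sub_max p : jacobi a b p -> jacobi_max p.
Proof.
move=> hp n; apply/eqP; rewrite -subr_eq0; apply/eqP; apply: eq0_normc.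
apply/eqP; rewrite -sqrf_eq0 eq_le sqr_ge0 andbT; apply/ler_addgt0Pr => e e0.
rewrite add0r.
pose S := (if n is m.+1 then a m else 0) ^+ 2 + b n ^+ 2 + a n ^+ 2.
have S0 : 0 <= S by rewrite !addr_ge0 ?sqr_ge0.
(* From [|d - r|^2 <= 2 |d|^2 + 2 |r|^2], where [|d|^2 <= e / C] and [|r|^2 <= 6 * S * (e / C)],
   real and imaginary parts giving [3 * S] each. *)
pose C := 2 + 12 * S.
have C0 : 0 < C by rewrite /C; lra.

have [q [_ hq] []] := hp (e / C) (divr_gt0 e0 C0).
rewrite !nrm2E !lte_fin => h1 h2.
pose d := p.2 - q.2; pose w := p.1 - q.1.
have -> : p.2 n - jacobi_action a b p.1 n = d n - jacobi_action a b w n.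
  rewrite [jacobi_action a b w n]jacobi_actionB -hq -[d n]/(p.2 n - q.2 n).
  by rewrite opprB addrA subrK.
rewrite sqr_normcE ReB ImB.
have hw i : Re (w i) ^+ 2 <= e / C /\ Im (w i) ^+ 2 <= e / C.
  have := le_trans (sqr_coord_le_nrm2 w i) (ltW h1); rewrite sqr_normcE.
  by have := sqr_ge0 (Re (w i)); have := sqr_ge0 (Im (w i)); split; lra.
have := sqr_real_jacobi_action_le n (fun i => (hw i).1).
have := sqr_real_jacobi_action_le n (fun i => (hw i).2).
have := le_trans (sqr_coord_le_nrm2 d n) (ltW h2); rewrite sqr_normcE.
rewrite -/S Re_jacobi_action Im_jacobi_action.
move: (real_jacobi_action _ n) (real_jacobi_action _ n) => r1 r2.
move: (Re (d n)) (Im (d n)) => d1 d2.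
have := sqr_ge0 (d1 + r1); have := sqr_ge0 (d2 + r2).
have eC : e = (2 + 12 * S) * (e / C) by rewrite -/C mulrC divfK// gt_eqF.
by move=> *; rewrite [leRHS]eC; lra.
Qed.


(** * Slowly varying cutoffs *)

Lemma sqr_add3_le (p q r : R) :
  (p + q + r) ^+ 2 <= 3 * (p ^+ 2 + q ^+ 2 + r ^+ 2).
Proof.
have := sqr_ge0 (p - q); have := sqr_ge0 (p - r); have := sqr_ge0 (q - r).
by lra.
Qed.

(** The slope [d / a k] offsets the weight [a k] of the matrix, while divergence of the sum of the
    [1 / a k] still brings the cutoff to 0. *)
Definition cutoff (d : R) (N n : nat) : R :=
  Num.max 0 (1 - d * \sum_(N <= k < n) (a k)^-1).

Section cutoff.
Hypothesis a_gt0 : forall n, 0 < a n.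
Variable d : R.
Hypothesis d_gt0 : 0 < d.

Lemma cutoff_ge0 N n : 0 <= cutoff d N n.
Proof. by rewrite le_max lexx. Qed.

Lemma cutoff_le1 N n : cutoff d N n <= 1.
Proof.
rewrite ge_max ler01 gerBl mulr_ge0 ?(ltW d_gt0)// sumr_ge0// => i _.
by rewrite invr_ge0 ltW.
Qed.

Lemma cutoff_eq1 N n : (n <= N)%N -> cutoff d N n = 1.
Proof. by move=> nN; rewrite /cutoff big_geq// mulr0 subr0; apply/max_idPr. Qed.

Lemma cutoff_lipschitz N n : `|a n * (cutoff d N n.+1 - cutoff d N n)| <= d.
Proof.
rewrite normrM gtr0_norm// mulrC -ler_pdivlMr//.
have [nN|] := ltnP n N.
  by rewrite !cutoff_eq1// ?(ltnW nN)// subrr normr0 divr_ge0// ltW.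
move=> Nn; rewrite /cutoff big_nat_recr//= mulrDr.
have : 0 < d / a n by rewrite divr_gt0.
move: (\sum_(_ <= _ < _) _) (d / a n) => S c c0.
rewrite opprD addrA; move: (1 - d * S) => r.
rewrite ler_norml; case: (leP 0 (r - c)) => h1; case: (leP 0 r) => h2; lra.
Qed.

Lemma cutoff_eventually0 N : (\sum_(0 <= n <oo) ((a n)^-1)%:E = +oo)%E ->
  exists M, forall n, (M <= n)%N -> cutoff d N n = 0.
Proof.
move=> carleman; have av0 n : 0 <= (a n)^-1 by rewrite invr_ge0 ltW.
have [M [NM hM]] := nneseries_pinfty_unbounded av0 carleman N d^-1.
exists M => n Mn; apply/max_idPl; rewrite subr_le0.
rewrite -ler_pdivrMl// mulr1; apply: (le_trans (ltW hM)).
by rewrite [leRHS](big_cat_nat NM Mn) /= lerDl sumr_ge0.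
Qed.

(** With [phi] the cutoff, [J x - J (phi x)] is [(1 - phi) J x], which vanishes before [N], plus a
    commutator with entries [a n * (phi_(n+1) - phi_n)] up to sign, of size at most [d]. *)
Lemma real_jacobi_action_cutoff N x n :
  (real_jacobi_action x n -
     real_jacobi_action (fun i => cutoff d N i * x i) n) ^+ 2 <=
  3 * ((if (N <= n)%N then real_jacobi_action x n ^+ 2 else 0) +
       d ^+ 2 * ((if n is m.+1 then x m ^+ 2 else 0) + x n.+1 ^+ 2)).
Proof.
have hd (c y : R) : `|c| <= d -> (c * y) ^+ 2 <= d ^+ 2 * y ^+ 2.
  move=> cd; rewrite exprMn ler_wpM2r ?sqr_ge0//.
  by rewrite -(real_normK (num_real c)) lerXn2r ?nnegrE// ltW.
pose q := if n is m.+1 then a m * (cutoff d N n - cutoff d N m) * x m else 0.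
have hq : q ^+ 2 <= d ^+ 2 * (if n is m.+1 then x m ^+ 2 else 0).
  rewrite /q; case: (n) => [|m]; first by rewrite expr0n mulr0.
  exact/hd/cutoff_lipschitz.
have hr := hd _ (x n.+1) (cutoff_lipschitz N n).
have hp : ((1 - cutoff d N n) * real_jacobi_action x n) ^+ 2 <=
    if (N <= n)%N then real_jacobi_action x n ^+ 2 else 0.
  case: leqP => nN; last by rewrite cutoff_eq1 ?(ltnW nN)// subrr mul0r expr0n.
  rewrite exprMn ler_piMl ?sqr_ge0// exprn_ile1// ?subr_ge0 ?cutoff_le1//.
  by rewrite gerBl cutoff_ge0.
have -> : real_jacobi_action x n -
     real_jacobi_action (fun i => cutoff d N i * x i) n =
   (1 - cutoff d N n) * real_jacobi_action x n + q -
   a n * (cutoff d N n.+1 - cutoff d N n) * x n.+1.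
  by rewrite /real_jacobi_action /q; case: (n) => [|m]; ring.
apply: (le_trans (sqr_add3_le _ _ _)); rewrite ler_pM2l// sqrrN -addrA.
by rewrite lerD// [leRHS]mulrDr lerD.
Qed.

Lemma cutoff_sub_sum u f N n : jacobi_max (u, f) ->
  \sum_(0 <= i < n) normc (f i -
    jacobi_action a b (fun i => (cutoff d N i)%:C * u i) i) ^+ 2 <=
  3 * (\sum_(N <= i < n) normc (f i) ^+ 2 + 2 * d ^+ 2 * nrm2 u).
Proof.
move=> uf.
have term i : normc (f i -
    jacobi_action a b (fun i => (cutoff d N i)%:C * u i) i) ^+ 2 <=
    3 * ((if (N <= i)%N then normc (f i) ^+ 2 else 0) +
     d ^+ 2 * ((if i is m.+1 then normc (u m) ^+ 2 else 0) +
               normc (u i.+1) ^+ 2)).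
  rewrite (uf i) sqr_normcE ReB ImB !Re_jacobi_action !Im_jacobi_action.
  have eR : (fun n => Re ((cutoff d N n)%:C * u n)) =
      (fun n => cutoff d N n * Re (u n)).
    by apply/funext => j; case: (u j) => x y /=; ring.
  have eI : (fun n => Im ((cutoff d N n)%:C * u n)) =
      (fun n => cutoff d N n * Im (u n)).
    by apply/funext => j; case: (u j) => x y /=; ring.
  rewrite eR eI.
  have := real_jacobi_action_cutoff N (fun n => Re (u n)) i.
  have := real_jacobi_action_cutoff N (fun n => Im (u n)) i.
  rewrite !sqr_normcE Re_jacobi_action Im_jacobi_action.
  by case: ifP => _; case: (i) => [|m]; rewrite ?sqr_normcE; lra.
apply: (le_trans (ler_sum _ (fun i _ => term i))).
rewrite -mulr_sumr ler_pM2l// big_split/= lerD//.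
  by apply: sum_nat_zero_head => i; [move/ltn_geF=> ->|move=> ->].
have -> : 2 * d ^+ 2 * nrm2 u = d ^+ 2 * (2 * nrm2 u) by ring.
rewrite -mulr_sumr ler_wpM2l ?sqr_ge0// big_split/=.
have h1 : \sum_(0 <= i < n) (if i is m.+1 then normc (u m) ^+ 2 else 0) <=
    nrm2 u.
  case: n => [|n]; first by rewrite big_geq// nrm2_ge0.
  by rewrite big_nat_recl//= add0r sum_le_nrm2.
have h2 : \sum_(0 <= i < n) normc (u i.+1) ^+ 2 <= nrm2 u.
  apply: le_trans (sum_le_nrm2 u n.+1).
  by rewrite [leRHS]big_nat_recl//= lerDr sqr_ge0.
by lra.
Qed.

End cutoff.

(** * The closure as the maximal operator, and its symmetry *)

Section self_adjoint.
Hypothesis a_gt0 : forall n, 0 < a n.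
Hypothesis carleman : (\sum_(0 <= n <oo) ((a n)^-1)%:E = +oo)%E.

(* Carleman's condition lets the cutoff decrease to 0 so slowly that its
   commutator with the Jacobi matrix has norm at most [2 * d]. *)
Lemma jacobi_max_sub p : jacobi_max p -> jacobi a b p.
Proof.
case: p => u f uf e e0.
(* Chosen so that [d ^+ 2 * nrm2 u <= e / 12]; the error in the image is then at most
   [3 * (e / 12 + 2 * (e / 12))]. *)
pose d := Num.min 1 (e / (12 * (nrm2 u + 1))).
have u1 : 0 < nrm2 u + 1 by rewrite ltr_wpDl// nrm2_ge0.
have d0 : 0 < d by rewrite lt_min ltr01 divr_gt0// mulr_gt0.
have dd : d ^+ 2 * nrm2 u <= e / 12.
  have d1 : d <= 1 by rewrite ge_min lexx.
  have d2 : d * (nrm2 u + 1) <= e / 12.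
    rewrite -ler_pdivlMr// -mulrA -invfM; rewrite ge_min; apply/orP; right.
    by rewrite [12 * _]mulrC lexx.
  apply: le_trans d2; rewrite expr2 -mulrA ler_pM2l//.
  by have := nrm2_ge0 u; nra.
clearbody d.
have e8 : 0 < e / 12 by rewrite divr_gt0.
have [N1 hN1] := l2_tail u e8; have [N2 hN2] := l2_tail f e8.
pose N := maxn N1 N2.
have [M hM] := cutoff_eventually0 a_gt0 d0 N carleman.
pose q1 (i : nat) : R[i]^o := (cutoff d N i)%:C * u i.
have q10 n : (M <= n)%N -> q1 n = 0.
  by move=> /hM; rewrite /q1 => ->; rewrite mul0r.
have q1l2 := in_l2_finite q10.
have q2l2 := in_l2_finite (jacobi_action_finite q10).
exists (L2 q1l2, L2 q2l2); first by split=> //; exists M.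
have tail v N' n : (N' <= N)%N ->
    (forall n, \sum_(N' <= i < n) normc (v i) ^+ 2 <= e / 12) ->
    \sum_(N <= i < n) normc (v i) ^+ 2 <= e / 12.
  move=> NN h; have [nN|/ltnW Nn] := leqP n N; first by rewrite big_geq// ltW.
  apply: le_trans (h n); rewrite [leRHS](big_cat_nat NN Nn) /= lerDr.
  by apply: sumr_ge0 => i _; exact: sqr_ge0.
rewrite !nrm2E !lte_fin; split.
  apply: (@le_lt_trans _ _ (e / 12)); last by lra.
  apply: nrm2_le => n.
  apply: le_trans (tail u N1 n (leq_maxl _ _) hN1).
  have t i : normc (u i - q1 i) ^+ 2 <=
      if (N <= i)%N then normc (u i) ^+ 2 else 0.
    rewrite /q1 -{1}[u i]mul1r -mulrBl normcM exprMn.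
    have -> : 1 - (cutoff d N i)%:C = (1 - cutoff d N i)%:C by rewrite rmorphB.
    rewrite /normc /= expr0n addr0 sqrtr_sqr real_normK ?num_real//.
    case: leqP => h; last by rewrite cutoff_eq1 ?(ltnW h)// subrr expr0n mul0r.
    rewrite ler_piMl ?sqr_ge0// exprn_ile1// ?subr_ge0 ?cutoff_le1//.
    by rewrite gerBl cutoff_ge0.
  apply: (le_trans (ler_sum _ (fun i _ => t i))).
  by apply: sum_nat_zero_head => i; [move/ltn_geF=> ->|move=> ->].
apply: (@le_lt_trans _ _ (9 * (e / 12))); last by lra.
apply: nrm2_le => n; apply: (le_trans (cutoff_sub_sum a_gt0 d0 N n uf)).
by have := tail f N2 n (leq_maxr _ _) hN2; lra.
Qed.

Lemma jacobiE : jacobi a b = jacobi_max.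
Proof.
by apply/seteqP; split => p; [exact: jacobi_sub_max|exact: jacobi_max_sub].
Qed.

Lemma jacobi_min_sub_max : jacobi_min a b `<=` jacobi_max.
Proof. by move=> p []. Qed.

Lemma jacobi_min_trunc N z :
  exists f, jacobi_min a b (l2_trunc N z, f).
Proof.
have hN n : (N <= n)%N -> trunc N z n = 0 by rewrite /trunc ltnNge => ->.
exists (L2 (in_l2_finite (jacobi_action_finite hN))).
by split => //; exists N.
Qed.

Lemma jacobi_sym p q : jacobi_max p -> jacobi_max q ->
  rip p.2 q.1 = rip p.1 q.2.
Proof.
rewrite -{1}jacobiE => hp hq; apply/eqP; rewrite -subr_eq0 -normr_le0.
apply/ler_addgt0Pr => e e0; rewrite add0r.
pose B := 2 + nrm2 q.1 + nrm2 q.2.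
have B0 : 0 < B by have := nrm2_ge0 q.1; have := nrm2_ge0 q.2; rewrite /B; lra.
(* Approximating [p] to within [1 / t ^+ 2] and using [rip_le] with weight [t] bounds the difference
   by [B / t], which is [e]. *)
pose t := B / e; have t0 : 0 < t by rewrite divr_gt0.
have t2 : 0 < (t ^+ 2)^-1 by rewrite invr_gt0 exprn_gt0.
have [r hr []] := hp _ t2; rewrite !nrm2E !lte_fin => h1 h2.
have -> : rip p.2 q.1 - rip p.1 q.2 =
    rip (p.2 - r.2) q.1 - rip (p.1 - r.1) q.2.
  by rewrite !ripBl (jacobi_min_sym hr hq); ring.
have k1 := rip_le (p.1 - r.1) q.2 t0; have k2 := rip_le (p.2 - r.2) q.1 t0.
apply: (le_trans (ler_normB _ _)).
have tt : t * (t ^+ 2)^-1 = t^-1 by field; rewrite gt_eqF.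
have m1 : t * nrm2 (p.1 - r.1) <= t^-1 by rewrite -tt ler_pM2l// ltW.
have m2 : t * nrm2 (p.2 - r.2) <= t^-1 by rewrite -tt ler_pM2l// ltW.
have -> : e = B * t^-1 by rewrite /t; field; rewrite !gt_eqF.
rewrite /B; lra.
Qed.

Lemma self_adjoint_jacobi : self_adjoint (jacobi a b).
Proof.
rewrite jacobiE; split.
  move=> u e e0; have [N hN] := l2_tail u (divr_gt0 e0 (ltr0n R 2)).
  exists (l2_trunc N u).
    by have [f /jacobi_min_sub_max] := jacobi_min_trunc N u; exists f.
  rewrite nrm2E lte_fin; apply: (@le_lt_trans _ _ (e / 2)); last by lra.
  apply: nrm2_le => n; apply: le_trans (hN n).
  apply: sum_nat_zero_head => i hi.
    rewrite -[X in normc X]/(u i - trunc N u i) /trunc hi subrr.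
    by rewrite normc0 expr0n.
  by rewrite -[X in normc X]/(u i - trunc N u i) /trunc ltnNge hi subr0.
apply/seteqP; split => p hp; last first.
  move=> q hq; rewrite !innerE; congr (_ +i* _); first exact: jacobi_sym.
  case: p hp => u f hp.
  exact: (jacobi_sym hq (jacobi_maxZ (0 +i* 1) hp)).
(* For the inclusion of the adjoint in [jacobi_max], elements of the adjoint are tested on finitely
   supported sequences, where Green's formula moves the matrix onto [p.1]. *)
have test z N : (forall n, (N <= n)%N -> z n = 0) ->
    \sum_(0 <= i < N.+1) rip_term (z i) (jacobi_action a b p.1 i - p.2 i) = 0.
  move=> hz; have q2 := in_l2_finite (jacobi_action_finite hz).
  have hq : jacobi_max (L2 (in_l2_finite hz), L2 q2) by [].
  have := congr1 (@complex.Re R) (hp _ hq); rewrite !Re_inner.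
  rewrite (@rip_finite _ (L2 q2) _ N.+1); last exact: jacobi_action_finite.
  rewrite (@rip_finite _ (L2 (in_l2_finite hz)) _ N.+1);
    last by move=> n /ltnW /hz.
  rewrite (green_finite _ hz) => /eqP; rewrite -subr_eq0 -sumrB => /eqP E.
  rewrite -[RHS]E.
  by apply: eq_bigr => i _; rewrite /rip_term ReB ImB; ring.
move=> n; apply/eqP; rewrite eq_sym -subr_eq0; apply/eqP.
set w := _ - _.
(* Only real parts are tested, so every complex multiple of the basis vector is used; [c = w] then
   gives [|w|^2 = 0]. *)
have delta (c : R[i]) : rip_term c w = 0.
  pose z (i : nat) : R[i]^o := if i == n then c else 0.
  have hz m : (n.+1 <= m)%N -> z m = 0 by rewrite /z => /gtn_eqF ->.
  have := test z n.+1 hz; rewrite big_nat_recr//= big_nat_recr//=.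
  have zn : z n = c by rewrite /z eqxx.
  rewrite zn (hz n.+1)// -/w.
  rewrite big_nat_cond big1 ?add0r; last first.
    move=> i /andP[/andP[_ hi] _]; rewrite /z (ltn_eqF hi).
    by rewrite /rip_term /= !mul0r addr0.
  by rewrite /rip_term /= !mul0r !addr0.
have := delta w; rewrite /rip_term -!expr2 -sqr_normcE => /eqP.
by rewrite sqrf_eq0 => /eqP /eq0_normc.
Qed.

End self_adjoint.

End jacobi_operator.

(** * Spectral measures *)

Section spectral_family_theory.
Variables (R : realType) (E : spectral_family R).
Implicit Types (A B : set (measurableTypeR R)) (u v w : l2 R).

Lemma rip_spectral_proj B u v : measurable B -> rip (E B u) v = rip u (E B v).
Proof. by move=> mB; rewrite -!Re_inner spectral_proj_sym. Qed.

Lemma spectral_proj_idem B u : measurable B -> E B (E B u) = E B u.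
Proof. by move=> mB; rewrite -spectral_projI// setIid. Qed.

Lemma spectral_projC A B u : measurable A -> measurable B ->
  E A (E B u) = E B (E A u).
Proof. by move=> mA mB; rewrite -!spectral_projI// setIC. Qed.

Lemma spectral_projB B u v : E B (u - v) = E B u - E B v.
Proof. exact: linearB. Qed.

Lemma spectral_projD B u v : E B (u + v) = E B u + E B v.
Proof. exact: linearD. Qed.

Lemma spectral_measureE u B : spectral_measure E u B = (nrm2 (E B u))%:E.
Proof. exact: nrm2E. Qed.

Lemma nrm2_spectral_proj B u : measurable B -> nrm2 (E B u) = rip (E B u) u.
Proof.
by move=> mB; rewrite -rip_nrm2 -rip_spectral_proj// spectral_proj_idem.
Qed.

Lemma nrm2_spectral_proj_le B u : measurable B -> nrm2 (E B u) <= nrm2 u.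
Proof.
move=> mB; have := nrm2_ge0 (u - E B u).
by rewrite nrm2B ripC -nrm2_spectral_proj//; lra.
Qed.

Lemma rip_spectral_proj_split A B w v : measurable A -> measurable B ->
  E A w = w -> E A v = 0 -> rip (E B w) (E B v) = 0.
Proof.
move=> mA mB Aw Av; rewrite -rip_spectral_proj// spectral_proj_idem//.
rewrite -{1}Aw spectral_projC// rip_spectral_proj// Av.
exact: rip0r.
Qed.

(** The projections commute, so [E B w] and [E B v] are orthogonal and the cross terms vanish. This
    lets the quadratic form alone show that the operator does not couple the range of [E A] with its
    kernel. *)
Lemma spectral_measure_reflect A w v : measurable A -> E A w = w -> E A v = 0 ->
  forall B, measurable B ->
  spectral_measure E (w + v) B = spectral_measure E (w - v) B.
Proof.
move=> mA Aw Av B mB; rewrite !spectral_measureE.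
rewrite spectral_projD spectral_projB nrm2D nrm2B.
by rewrite (rip_spectral_proj_split mA mB Aw Av) mulr0 addr0 subr0.
Qed.

Section localized.
Variables (I : set (measurableTypeR R)) (l e : R).
Hypotheses (mI : measurable I) (Il : forall x, I x -> l - e <= x <= l + e).
Variable w : l2 R.
Hypothesis Iw : E I w = w.

Local Notation mu := (spectral_measure E w).

Let muIC : mu (~` I) = 0%E.
Proof.
rewrite spectral_measureE -Iw -spectral_projI//; last exact: measurableC.
by rewrite setICl spectral_proj0 nrm20.
Qed.

Let muI : mu I = (nrm2 w)%:E.
Proof. by rewrite spectral_measureE Iw. Qed.

Let TI : setT `\` ~` I = I.
Proof. by rewrite setTD setCK. Qed.

(** The measure of [w] is carried by the bounded set [I]; a finite second moment is what puts [w] in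
    the domain. *)
Lemma localized_second_moment :
  (\int[spectral_measure E w]_x (x ^+ 2)%:E < +oo)%E.
Proof.
have mx2 (D : set (measurableTypeR R)) :
    measurable_fun D (fun x : measurableTypeR R => (x ^+ 2)%:E : \bar R).
  by apply/measurable_EFinP; exact: exprn_measurable.
rewrite (ge0_negligible_integral (measurableC mI) measurableT (mx2 setT) _
  muIC);
  last by move=> x _; rewrite lee_fin sqr_ge0.
rewrite TI.
apply: (@le_lt_trans _ _ (\int[mu]_(x in I) ((`|l| + e) ^+ 2)%:E)%E).
  apply: ge0_le_integral => //.
  - by move=> x _; rewrite lee_fin sqr_ge0.
  - move=> x /Il h; rewrite lee_fin -(real_normK (num_real x)).
    have hx : `|x| <= `|l| + e.
      have := ler_norm l; have := ler_norm (- l); rewrite normrN ler_norml.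
      by lra.
    by rewrite lerXn2r// nnegrE (le_trans _ hx).
by rewrite integral_cst// [X in (_ * X)%E]muI -EFinM ltry.
Qed.

Lemma localized_first_moment :
  `|\int[spectral_measure E w]_x x - l * nrm2 w| <= e * nrm2 w.
Proof.
have iI : mu.-integrable I (EFin \o id).
  apply: measurable_bounded_integrable => //.
  - by rewrite [X in (X < _)%E]muI ltry.
  - exists (`|l| + e); split; first exact: num_real.
    move=> M hM x /Il h; apply: le_trans (ltW hM).
    have := ler_norm l; have := ler_norm (- l); rewrite normrN ler_norml.
    by lra.
have iC c : mu.-integrable I (EFin \o cst c).
  apply: measurable_bounded_integrable => //; last exact: bounded_cst.
  by rewrite [X in (X < _)%E]muI ltry.
have mid : measurable_fun setT (EFin \o (id : measurableTypeR R -> R)).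
  exact/measurable_EFinP.
have iT : mu.-integrable setT (EFin \o id).
  apply/(negligible_integrable (measurableC mI) measurableT mid muIC).
  by rewrite TI.
have -> : \int[mu]_x x = \int[mu]_(x in I) x.
  rewrite /Rintegral (negligible_integral (measurableC mI) measurableT iT muIC).
  by rewrite TI.
have h1 := le_Rintegral mI iI (iC (l + e)) (fun x Ix => proj2 (andP (Il Ix))).
have h2 := le_Rintegral mI (iC (l - e)) iI (fun x Ix => proj1 (andP (Il Ix))).
move: h1 h2; rewrite !Rintegral_cst// -[X in fine X]/(mu I) !muI /= => h1 h2.
by rewrite ler_norml; apply/andP; split; lra.
Qed.

End localized.
End spectral_family_theory.

(** * Vectors in the range of [E I] as approximate eigenvectors *)

Section spectral_estimate.
Variables (R : realType) (a b : nat -> R) (E : spectral_family R).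
Hypothesis a_gt0 : forall n, 0 < a n.
Hypothesis carleman : (\sum_(0 <= n <oo) ((a n)^-1)%:E = +oo)%E.
Hypothesis hE : spectral_family_of (jacobi a b) E.

Let rip_moment u f : jacobi_max a b (u, f) ->
  rip f u = \int[spectral_measure E u]_x x.
Proof.
by rewrite -(jacobiE b a_gt0 carleman) => /(hE.2 _ _); rewrite -Re_inner => ->.
Qed.

Section localized.
Variables (I : set (measurableTypeR R)) (l e : R).
Hypotheses (mI : measurable I) (Il : forall x, I x -> l - e <= x <= l + e).
Hypothesis e_gt0 : 0 < e.

Lemma localized_domain w : E I w = w -> exists f, jacobi_max a b (w, f).
Proof.
move=> Iw; have /hE.1[f hf] := localized_second_moment mI Il Iw.
by exists f; rewrite -(jacobiE b a_gt0 carleman).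
Qed.

Let form_bound w f : E I w = w -> jacobi_max a b (w, f) ->
  `|rip f w - l * nrm2 w| <= e * nrm2 w.
Proof.
by move=> Iw /rip_moment ->; have := localized_first_moment mI Il Iw.
Qed.

(** The vectors [w + v] and [w - v] have equal spectral measures, hence equal values of the
    quadratic form; by symmetry these differ by [4 * rip f v]. *)
Lemma rip_jacobi_split w f v g : E I w = w -> E I v = 0 ->
  jacobi_max a b (w, f) -> jacobi_max a b (v, g) -> rip f v = 0.
Proof.
move=> Iw Iv wf vg.
have eqm := spectral_measure_reflect mI Iw Iv.
have : rip (f + g) (w + v) = rip (f - g) (w - v).
  rewrite (rip_moment (jacobi_maxD wf vg)) (rip_moment (jacobi_maxB wf vg)).
  rewrite /Rintegral; congr fine; apply: eq_measure_integral => B mB _.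
  exact: eqm.
have := jacobi_sym a_gt0 carleman vg wf; rewrite /= (ripC v f).
by rewrite !(ripDl, ripDr, ripNl, ripNr); lra.
Qed.

(** On the range of [E I] the form of [J - l] is bounded by [e]; polarization turns this into a norm
    bound, as for any symmetric operator. *)
Lemma localized_residual_le w f : E I w = w -> jacobi_max a b (w, f) ->
  nrm2 (f - l%:C *: w) <= e ^+ 2 * nrm2 w.
Proof.
move=> Iw wf; set g := f - _; apply: nrm2_le => n.
(* Truncations of the residual [g] lie in the domain, and projecting [v] to the range of [E I]
   leaves its pairing with [g] unchanged. *)
pose v := l2_trunc n g.
have vE : \sum_(0 <= i < n) normc (g i) ^+ 2 = nrm2 v.
  rewrite -rip_nrm2 (@rip_finite _ v v n); last first.
    by move=> i ni; rewrite /v /= /trunc ltnNge ni.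
  apply: eq_big_nat => i /andP[_ ilt].
  by rewrite sqr_normcE /rip_term /v /= /trunc ilt; ring.
have gv : rip g v = nrm2 v.
  rewrite -vE ripC (@rip_finite _ v g n); last first.
    by move=> i ni; rewrite /v /= /trunc ltnNge ni.
  apply: eq_big_nat => i /andP[_ ilt].
  by rewrite sqr_normcE /rip_term /v /= /trunc ilt; ring.
rewrite vE; have [gv' /jacobi_min_sub_max vgv] := jacobi_min_trunc a b n g.
rewrite -/v in vgv; clearbody v.
pose v1 := E I v; have Iv1 : E I v1 = v1 by exact: spectral_proj_idem.
have [f1 vf1] := localized_domain Iv1.
have Iv2 : E I (v - v1) = 0 by rewrite spectral_projB Iv1 subrr.
have fv2 := rip_jacobi_split Iw Iv2 wf (jacobi_maxB vgv vf1).
have wv2 : rip w (v - v1) = 0.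
  by rewrite -Iw rip_spectral_proj// Iv2 rip0r.
have gv1 : rip g v1 = nrm2 v.
  rewrite -gv; have : rip g (v - v1) = 0.
    by rewrite ripBl ripZl fv2 wv2 mulr0 subrr.
  by rewrite ripBr; lra.
have nv1 : nrm2 v1 <= nrm2 v by exact: nrm2_spectral_proj_le.
(* Polarization bounds [4 * rip g v'] by [2 * e * (nrm2 w + nrm2 v')]; with the scale [1 / e], half
   of the left side absorbs the last term. *)
pose c := e^-1; have ce : c * e = 1 by rewrite mulVf// gt_eqF.
have c0 : 0 < c by rewrite invr_gt0.
pose v' := c%:C *: v1; pose f' := c%:C *: f1.
have vf' : jacobi_max a b (v', f') by exact: jacobi_maxZ.
have Iv' : E I v' = v' by rewrite /v' linearZ /= Iv1.
have h1 : `|rip (f + f') (w + v') - l * nrm2 (w + v')| <= e * nrm2 (w + v').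
  by apply: form_bound (jacobi_maxD wf vf'); rewrite spectral_projD Iw Iv'.
have h2 : `|rip (f - f') (w - v') - l * nrm2 (w - v')| <= e * nrm2 (w - v').
  by apply: form_bound (jacobi_maxB wf vf'); rewrite spectral_projB Iw Iv'.
have sym : rip f' w = rip f v'.
  by rewrite (ripC f); exact: (jacobi_sym a_gt0 carleman vf' wf).
have gv'E : rip g v' = c * nrm2 v by rewrite ripZr gv1.
have gE : rip g v' = rip f v' - l * rip w v' by rewrite ripBl ripZl.
have nv' : nrm2 v' <= c ^+ 2 * nrm2 v.
  by rewrite nrm2Z ler_wpM2l// sqr_ge0.
have key : 4 * (c * nrm2 v) <= 2 * (e * (nrm2 w + nrm2 v')).
  rewrite -gv'E gE; move: h1 h2; rewrite nrm2D nrm2B.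
  rewrite !(ripDl, ripDr, ripNl, ripNr) !ler_norml sym.
  move=> /andP[_ h1] /andP[h2 _].
  by lra.
have : e * nrm2 v' <= c * nrm2 v.
  apply: (le_trans (ler_wpM2l (ltW e_gt0) nv')).
  by rewrite expr2 !mulrA (mulrC e) ce mul1r.
move=> h3; have : c * nrm2 v <= e * nrm2 w by lra.
rewrite -(ler_pM2l e_gt0) mulrA [e * c]mulrC ce mul1r => /le_trans; apply.
by rewrite mulrA expr2.
Qed.

End localized.
End spectral_estimate.

(** * Comparison of spectral measures with Lebesgue measure *)

Section absolute_continuity.
Variables (R : realType) (am : R) (a b : nat -> R) (beta_oo : R).
Hypotheses (a_gt0 : forall n, 0 < a n)
  (a_cvg : a @ \oo --> +oo)
  (beta_cvg : jacobi_beta am a b @ \oo --> beta_oo)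
  (beta_oo_lt1 : `|beta_oo| < 1)
  (alpha_l1 : in_l1 (telescope (jacobi_alpha am a)))
  (beta_l1 : in_l1 (telescope (jacobi_beta am a b)))
  (k_l1 : in_l1 (fun n => jacobi_k am a n - 1))
  (carleman : (\sum_(0 <= n <oo) ((a n)^-1)%:E = +oo)%E).
Variable E : spectral_family R.
Hypothesis hE : spectral_family_of (jacobi a b) E.

Definition l2_delta m : l2 R :=
  l2_trunc m.+1 (fun i => if i == m then 1 else 0).

Lemma rip_delta u m : rip u (l2_delta m) = complex.Re (u m).
Proof.
rewrite ripC (@rip_finite _ (l2_delta m) u m.+1); last first.
  by move=> n mn; rewrite /l2_delta /= /trunc ltnNge mn.
rewrite big_nat_recr//= big_nat_cond big1 ?add0r; last first.
  move=> i /andP[/andP[_ im] _].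
  by rewrite /trunc (ltn_trans im)// (ltn_eqF im) /rip_term /= !mul0r addr0.
by rewrite /trunc ltnSn eqxx /rip_term /= mul1r mul0r addr0.
Qed.

Lemma spectral_delta_small M m : 0 <= M -> exists C : R, 0 <= C /\
  forall (I : set (measurableTypeR R)) (l e : R), measurable I ->
    (forall x : R, I x -> l - e <= x <= l + e) ->
    `|l| <= M -> 0 < e -> e <= 1 ->
    nrm2 (E I (l2_delta m)) <= C * e.
Proof.
move=> M0; have [C [C0 hC]] := eps_solution_bound a_gt0 a_cvg beta_cvg
  beta_oo_lt1 alpha_l1 beta_l1 k_l1 carleman m M0.
exists C; split=> // I l e mI Il lM e0 e1.
pose w := E I (l2_delta m).
have Iw : E I w = w by exact: spectral_proj_idem.
have [f wf] := localized_domain a_gt0 carleman hE mI Il Iw.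
have res := localized_residual_le a_gt0 carleman hE mI Il e0 Iw wf.
set g := f - _ in res.
have wm : complex.Re (w m) = nrm2 w by rewrite -rip_delta -nrm2_spectral_proj.
have sumRe (u : l2 R) n : \sum_(0 <= i < n) complex.Re (u i) ^+ 2 <= nrm2 u.
  apply: le_trans (sum_le_nrm2 u n); apply: ler_sum => i _.
  by rewrite sqr_normcE lerDl sqr_ge0.
have := hC l e (nrm2 w) (fun i => complex.Re (w i)) (fun i => complex.Re (g i))
  lM e0 e1.
rewrite wm -/w => H.
(* Since [w_m] is [nrm2 w], the bound is quadratic in [nrm2 w] on the left and linear on the right;
   one factor then cancels. *)
have {H} : nrm2 w ^+ 2 <= C * (e * nrm2 w).
  apply: H; split=> // n; first exact: le_trans res.
  have -> : g n.+1 = f n.+1 - l%:C * w n.+1 by [].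
  rewrite ReB (wf n.+1) Re_jacobi_action /real_jacobi_action /=.
  by case: (w n.+1) => x y /=; ring.
have := nrm2_ge0 w; rewrite le_eqVlt => /predU1P[<- _|w0].
  by rewrite mulr_ge0// ltW.
by rewrite expr2 mulrA ler_pM2r.
Qed.

(** [I] may be any measurable part of the interval, since covering intervals will be cut with a null
    set. Intervals longer than 2 are handled by the trivial bound [nrm2 (l2_delta m)]. *)
Lemma spectral_delta_le_length M m : 0 <= M -> exists C : R, 0 <= C /\
  forall (I : set (measurableTypeR R)) (x y : R), measurable I -> x < y ->
    (forall t : R, I t -> x < t < y) -> (forall t : R, I t -> `|t| <= M) ->
    nrm2 (E I (l2_delta m)) <= C * (y - x).
Proof.
(* An interval of length at most 2 that meets [[-M, M]] has its centre within [M + 1] of 0. *)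
move=> M0; have M1 : 0 <= M + 1 by lra.
have [C [C0 hC]] := spectral_delta_small m M1.
exists (C + nrm2 (l2_delta m)); split; first by rewrite addr_ge0 ?nrm2_ge0.
move=> I x y mI xy Ixy IM; have n0 := nrm2_ge0 (l2_delta m).
have [yx2|yx2] := lerP (y - x) 2; last first.
  apply: (le_trans (nrm2_spectral_proj_le _ _ mI)).
  have : 0 <= C * (y - x) by rewrite mulr_ge0//; lra.
  have : 0 <= nrm2 (l2_delta m) * (y - x - 2) by rewrite mulr_ge0//; lra.
  by lra.
have [->|/set0P[t It]] := eqVneq I set0.
  rewrite spectral_proj0 nrm20.
  by apply: mulr_ge0; [exact: addr_ge0|lra].
apply: (@le_trans _ _ (C * ((y - x) / 2))).
  apply: (hC I ((x + y) / 2)) => //; last 3 first.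
  - have : exists2 s : R, x < s < y & `|s| <= M.
      by exists t; [exact: Ixy|exact: IM].
    move=> [s /andP[? ?]]; rewrite !ler_norml => /andP[? ?].
    by apply/andP; split; lra.
  - by lra.
  - by lra.
  by move=> s /Ixy/andP[? ?]; apply/andP; split; lra.
have : 0 <= C * (y - x) by rewrite mulr_ge0//; lra.
have : 0 <= nrm2 (l2_delta m) * (y - x) by rewrite mulr_ge0//; lra.
by lra.
Qed.

(** A null set has open interval covers of arbitrarily small total length; intersecting them with
    [B] stays in [[-M, M]], where one constant [C] serves all. *)
Lemma spectral_delta_null_bounded M m (B : set (measurableTypeR R)) : 0 <= M ->
  measurable B -> (forall t : R, B t -> `|t| <= M) ->
  lebesgue_measure B = 0%E -> spectral_measure E (l2_delta m) B = 0%E.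
Proof.
move=> M0 mB BM B0.
have [C [C0 hC]] := spectral_delta_le_length m M0.
apply/eqP; rewrite eq_le measure_ge0 andbT; apply/lee_addgt0Pr => e e0.
rewrite add0e; have eC : 0 < e / (C + 1) by rewrite divr_gt0// ltr_wpDl.
have cov : ereal_inf [set (\sum_(k <oo) (@wlength R idfun) (F k))%E |
    F in open_itv_cover B] = 0%E.
  by rewrite -outer_measure_open_itv_cover -[RHS]B0.
have [] := @lb_ereal_inf_adherent _ [set (\sum_(k <oo)
  (@wlength R idfun) (F k))%E | F in open_itv_cover B] _ eC;
  first by rewrite cov.
move=> _ [F [Fitv BF] <-]; rewrite cov add0e => Fe.
have mF k : @measurable _ (measurableTypeR R) (F k).
  by have [ab ->] := Fitv k; exact: measurable_itv.
have mFB k : @measurable _ (measurableTypeR R) (F k `&` B).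
  exact: measurableI (mF k) mB.
apply: (@le_trans _ _
  (\sum_(k <oo) spectral_measure E (l2_delta m) (F k `&` B))%E).
  apply: measure_sigma_subadditive => //.
  by move=> t Bt; have [k _ Fkt] := BF t Bt; exists k.
apply: (@le_trans _ _ (\sum_(k <oo) (C%:E * (@wlength R idfun) (F k)))%E).
  apply: lee_nneseries => k _.
    by move=> *; exact: measure_ge0.
  rewrite spectral_measureE; have [[x y] Fk] := Fitv k.
  have [xy|yx] := ltP x y; last first.
    have -> : F k = set0 by rewrite Fk set_itv_ge// bnd_simp -leNgt.
    by rewrite set0I spectral_proj0 wlength0 mule0 nrm20.
  have -> : wlength idfun (F k) = (y - x)%:E.
    by rewrite Fk wlength_itv_bnd// ltW.
  rewrite -EFinM lee_fin.
  apply: hC => //.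
    by move=> t [+ _]; rewrite Fk /= in_itv.
  by move=> t [_ /BM].
rewrite nneseriesZl; last by move=> k _; exact: wlength_ge0.
apply: (@le_trans _ _ (C%:E * (e / (C + 1))%:E)%E).
  by rewrite lee_wpmul2l ?lee_fin// ltW.
rewrite -EFinM lee_fin mulrA ler_pdivrMr ?ltr_wpDl//; nra.
Qed.

Lemma spectral_delta_null m (B : set (measurableTypeR R)) : measurable B ->
  lebesgue_measure B = 0%E -> E B (l2_delta m) = 0.
Proof.
move=> mB B0.
pose BM (k : nat) : set (measurableTypeR R) := B `&` [set` `[- k%:R, k%:R]].
have mBM k : measurable (BM k).
  by apply: measurableI => //; exact: measurable_itv.
have : spectral_measure E (l2_delta m) B = 0%E.
  have -> : B = \bigcup_k BM k.
    rewrite -setI_bigcupr; apply/esym/setIidPl => t _.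
    exists (Num.truncn `|t|).+1 => //=; rewrite in_itv /= -ler_norml.
    exact/ltW/truncnS_gt.
  apply: measure_negligible; first exact: bigcupT_measurable.
  apply: negligible_bigcup => k; apply/negligibleP => //.
  apply: (@spectral_delta_null_bounded k%:R) => //.
  - by move=> t [_] /=; rewrite in_itv /= -ler_norml.
  - apply/eqP; rewrite eq_le measure_ge0 andbT -B0 le_measure ?inE//.
    exact: subIsetl.
rewrite spectral_measureE => -[n0].
apply/val_inj/funext => i; apply: eq0_normc; apply/eqP.
by rewrite -sqrf_eq0 eq_le sqr_ge0 andbT -n0 sqr_coord_le_nrm2.
Qed.

(** By symmetry of the projection, the real coordinates of [E B u] are pairings of [u] with
    [E B delta_i], which is 0; the imaginary ones are those of [E B (i u)] up to sign. *)
Lemma absolutely_continuous_jacobi u :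
  spectral_measure E u `<< @lebesgue_measure R.
Proof.
apply/null_content_dominatesP => B mB B0.
have [->//|u0] := eqVneq (spectral_measure E u B) 0%E; exfalso.
move/eqP: u0; apply; rewrite spectral_measureE; congr (_%:E).
apply/eqP; rewrite eq_le nrm2_ge0 andbT; apply: nrm2_le => n.
rewrite big1// => i _.
have Ez v : Re (E B v i) = 0.
  by rewrite -rip_delta rip_spectral_proj// spectral_delta_null// rip0r.
rewrite sqr_normcE Ez expr0n add0r.
have -> : Im (E B u i) = - Re (E B ((0 +i* 1) *: u) i).
  transitivity (- Re ((0 +i* 1) * E B u i)); last by rewrite linearZ.
  by case: (E B u i) => x y /=; ring.
by rewrite Ez oppr0 expr0n.
Qed.

End absolute_continuity.

Unset Implicit Arguments.

Theorem corollary5p8 (R : realType) (am : R) (a b : nat -> R) (beta_oo : R)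
    (am_gt0 : 0 < am) (a_gt0 : forall n, 0 < a n)
    (a_cvg : a @ \oo --> +oo)
    (beta_cvg : jacobi_beta am a b @ \oo --> beta_oo)
    (beta_oo_lt1 : `|beta_oo| < 1)
    (alpha_l1 : in_l1 (telescope (jacobi_alpha am a)))
    (beta_l1 : in_l1 (telescope (jacobi_beta am a b)))
    (k_l1 : in_l1 (fun n => jacobi_k am a n - 1))
    (carleman : (\sum_(0 <= n <oo) ((a n)^-1)%:E = +oo)%E) :
  absolutely_continuous_spectrum (jacobi a b).
Proof.
split; first exact: self_adjoint_jacobi a_gt0 carleman.
by move=> E hE u; exact: (absolutely_continuous_jacobi a_gt0 a_cvg beta_cvg
  beta_oo_lt1 alpha_l1 beta_l1 k_l1 carleman hE).
Qed.
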